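(* There exist absolute constants $B>0$, $C>0$ and $b>1$ such that the following holds. Let $P$ be a set of $m$ distinct points and $L$ a set of $n$ distinct lines in $\mathbb{R}^3$, and let $s\le n$ be a parameter such that no plane contains more than $s$ lines of $L$. Then $$ I(P,L) \le A_{m,n}\left(m^{1/2}n^{3/4} + m\right) + B\left(m^{2/3}n^{1/3}s^{1/3} + n\right), $$ where $$ A_{m,n} \le C\, b^{\frac{\log (m^2n)}{\log (n^3/m^2)}} \quad \text{for } m\le n^{3/2}, \qquad A_{m,n} \le C\, b^{\frac{\log (m^3/n^4)}{\log (m^2/n^3)}} \quad \text{for } m\ge n^{3/2}. $$
   Context: For a set $P$ of points and a set $L$ of lines in $\mathbb{R}^3$, $I(P,L)$ denotes the number of incidences, i.e., the number of pairs $(p,\ell)\in P\times L$ with $p\in\ell$.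
   Formalization: The case m = n^{3/2} is excluded: there both exponents bounding A_{m,n} have denominator log 1 = 0 (for example m = 8, n = 4), so the stated bound is undefined; all other m and n are covered. *)

(* Defs.v *)
From HB Require Import structures.
From mathcomp Require Import all_boot all_order all_algebra.
From mathcomp Require Import finmap.
From mathcomp Require Import all_classical all_reals all_analysis.
Set Implicit Arguments. Unset Strict Implicit. Unset Printing Implicit Defensive.
Import Order.TTheory GRing.Theory Num.Theory.
Local Open Scope classical_set_scope.
Local Open Scope ring_scope.

Definition dot3 {R : realType} (a x : 'rV[R]_3) : R := \sum_(i < 3) a 0 i * x 0 i.

Definition is_line {R : realType} (l : set 'rV[R]_3) : Prop :=
  exists p d : 'rV[R]_3, d != 0 /\ l = [set p + t *: d | t in [set: R]].

Definition is_plane {R : realType} (H : set 'rV[R]_3) : Prop :=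
  exists (a : 'rV[R]_3) (c : R), a != 0 /\ H = [set x | dot3 a x = c].

Definition incidences {R : realType} (P : {fset 'rV[R]_3}) (L : {fset set 'rV[R]_3}) : nat :=
  \sum_(p <- P) #|` [fset l in L | p \in l]%fset |.

Definition lines_in {R : realType} (L : {fset set 'rV[R]_3}) (H : set 'rV[R]_3) : nat :=
  #|` [fset l in L | `[< (l `<=` H)%classic >] ]%fset |.

(* Main.v *)
(* The degree of the partitioning polynomial f is of order m^(1/2) / n^(1/4): it cuts
   space into cells with few points each, every line meets few cells, and the planar
   Szemeredi-Trotter bound, applied in each cell after projection, controls the points off
   Z(f).  On Z(f), fix a direction v in which f does not vanish identically at any of the
   points, and let the order of a point (of a line) be the order of vanishing of f in the
   direction v at that point (generically along that line).  A line carries at most deg f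
   points of larger order.  If p and l have the same order k, then p is a regular point of
   the surface S_k where the (k-1)-st derivative of f in the direction v vanishes, and l
   lies on S_k.  Three lines of S_k through a regular point lie in its tangent plane and
   annihilate the second fundamental form; hence, apart from two incidences per point and
   O(deg f) incidences per line, only lines along which that form vanishes matter.  Along
   such a line the tangent plane is constant, so these incidences split into disjoint
   planar families with at most s lines each.  Handling every order of vanishing at once
   makes an induction on the number of lines unnecessary, so A can be bounded by a
   constant.

   The polynomial ham sandwich theorem behind the partition comes from a Borsuk-Ulam
   theorem, proved by Ky Fan's parity argument on iterated barycentric subdivisions of the
   crosspolytope. *)
Require Import Defs.
From HB Require Import structures.
From mathcomp Require Import all_boot all_order all_algebra.
From mathcomp Require Import finmap.
From mathcomp Require Import all_classical all_reals all_analysis.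
From mathcomp Require Import ring lra zify.
Set Implicit Arguments. Unset Strict Implicit. Unset Printing Implicit Defensive.
Import Order.TTheory GRing.Theory Num.Theory.

(** * Incidence counting *)

Lemma sum_seq_const (T : Type) (s : seq T) c : (\sum_(x <- s) c = size s * c)%N.
Proof. by rewrite big_const_seq count_predT iter_addn_0 mulnC. Qed.

Lemma count_le1 (T : eqType) (a : pred T) (s : seq T) : uniq s ->
  (forall x y, x \in s -> y \in s -> a x -> a y -> x = y) -> (count a s <= 1)%N.
Proof.
move=> us h; rewrite -size_filter.
case e : (seq.filter a s) => [|x [|y r]] //.
have ms z : z \in [:: x, y & r] -> (z \in s) && a z by rewrite -e mem_filter andbC.
have /andP[xs ax] := ms x (mem_head _ _).
have /andP[ys ay] : (y \in s) && a y by apply: ms; rewrite !inE eqxx orbT.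
have := filter_uniq a us; rewrite e /= (h x y xs ys ax ay) inE eqxx.
by [].
Qed.

Section Incidences.
Variables (T U : eqType).
Implicit Types (inc : T -> U -> bool) (P : seq T) (L : seq U).

Definition inc_count inc P L : nat := \sum_(p <- P) \sum_(l <- L) inc p l.

Lemma inc_countE inc P L : inc_count inc P L = \sum_(l <- L) count (inc^~ l) P.
Proof.
rewrite /inc_count exchange_big; apply: eq_bigr => l _.
by rewrite -sum1_count [RHS]big_mkcond; apply: eq_bigr => p _; case: (inc _ _).
Qed.

Lemma inc_countEl inc P L : inc_count inc P L = \sum_(p <- P) count (inc p) L.
Proof.
apply: eq_bigr => p _.
by rewrite -sum1_count [RHS]big_mkcond; apply: eq_bigr => l _; case: (inc _ _).
Qed.

Lemma inc_count_sub inc inc' P L :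
  (forall p l, p \in P -> l \in L -> inc p l -> inc' p l) ->
  (inc_count inc P L <= inc_count inc' P L)%N.
Proof.
move=> h; rewrite /inc_count big_seq [leqRHS]big_seq; apply: leq_sum => p hp.
rewrite big_seq [leqRHS]big_seq; apply: leq_sum => l hl.
by case i : (inc p l) => //; rewrite (h _ _ hp hl i).
Qed.

Lemma inc_count_or inc inc1 inc2 P L :
  (forall p l, p \in P -> l \in L -> inc p l -> inc1 p l || inc2 p l) ->
  (inc_count inc P L <= inc_count inc1 P L + inc_count inc2 P L)%N.
Proof.
move=> h; rewrite /inc_count -big_split big_seq [leqRHS]big_seq; apply: leq_sum => p hp /=.
rewrite -big_split big_seq [leqRHS]big_seq; apply: leq_sum => l hl /=.
by case i : (inc p l) => //; case: (inc1 p l) (h _ _ hp hl i) => //= ->; rewrite addn1.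
Qed.

Lemma inc_count_lines inc P L k : (forall l, l \in L -> (count (inc^~ l) P <= k)%N) ->
  (inc_count inc P L <= k * size L)%N.
Proof.
move=> h; rewrite inc_countE big_seq mulnC -sum_seq_const [leqRHS]big_seq.
exact: leq_sum.
Qed.

Lemma inc_count_points inc P L k : (forall p, p \in P -> (count (inc p) L <= k)%N) ->
  (inc_count inc P L <= k * size P)%N.
Proof.
move=> h; rewrite inc_countEl big_seq mulnC -sum_seq_const [leqRHS]big_seq.
exact: leq_sum.
Qed.

Definition linear_inc inc := forall p p' l l',
  p != p' -> inc p l -> inc p' l -> inc p l' -> inc p' l' -> l = l'.

(** Once a line has a point [p0], every further point on it gives a pair of distinct points of [P],
    and by linearity such a pair lies on at most one line; hence the pairs number at most
    [size P ^ 2] in all. *)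
Lemma inc_count_trivial inc P L : linear_inc inc -> uniq P -> uniq L ->
  (inc_count inc P L <= size L + size P ^ 2)%N.
Proof.
move=> lin uP uL; pose pairs l := \sum_(p <- P) \sum_(p' <- P) (p != p') && inc p l && inc p' l.
have h1 l : (count (inc^~ l) P <= 1 + pairs l)%N.
  have [|nh] := boolP (has (inc^~ l) P); last first.
    by rewrite has_count -eqn0Ngt in nh; rewrite (eqP nh).
  case/hasP=> p0 p0P ip0; rewrite /pairs (big_rem p0) //=.
  apply: (@leq_trans (1 + \sum_(p' <- P) (p0 != p') && inc p0 l && inc p' l)); last first.
    by rewrite leq_add2l leq_addr.
  rewrite ip0 -sum1_count big_mkcond (big_rem p0) //= ip0 leq_add2l.
  rewrite [leqRHS](big_rem p0) //=; apply: leq_trans (leq_addl _ _).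
  rewrite big_seq [leqRHS]big_seq; apply: leq_sum => p; rewrite mem_rem_uniq // !inE => /andP[hp _].
  by rewrite eq_sym hp; case: (inc p l).
rewrite inc_countE; apply: leq_trans (leq_sum _ (fun l _ => h1 l)) _.
rewrite big_split sum_seq_const muln1 leq_add2l /pairs exchange_big /=.
rewrite -mulnn -sum_seq_const; apply: leq_sum => p _.
rewrite exchange_big -[leqRHS]muln1 -sum_seq_const; apply: leq_sum => p' _.
rewrite (eq_bigr (fun l => if (p != p') && inc p l && inc p' l then 1 else 0)%N); last first.
  by move=> l _; case: ifP.
rewrite -big_mkcond sum1_count; apply: count_le1 => // l l' _ _.
by move=> /andP[/andP[pp' i1] i2] /andP[/andP[_ i3] i4]; exact: lin i1 i2 i3 i4.
Qed.

Section Classes.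
Variables (K : eqType) (key : T -> K) (inc : T -> U -> bool) (P : seq T) (L : seq U).
Definition keys := undup (map key P).
Definition class_pts c := [seq p <- P | key p == c].
Definition class_lines c := [seq l <- L | has (inc^~ l) (class_pts c)].

Lemma sum_by_key (F : T -> nat) :
  \sum_(p <- P) F p = \sum_(c <- keys) \sum_(p <- class_pts c) F p.
Proof.
under [RHS]eq_bigr do rewrite big_filter big_mkcond.
rewrite exchange_big /=; rewrite big_seq [RHS]big_seq; apply: eq_bigr => p pP.
rewrite (bigD1_seq (key p)) ?undup_uniq ?mem_undup ?map_f //= eqxx big1 ?addn0 // => c.
by rewrite eq_sym => /negbTE ->.
Qed.

(** A point has exactly one key, and a line without points in a class contributes nothing there, so
    localising to the classes loses no incidence. *)
Lemma inc_count_classes :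
  inc_count inc P L = \sum_(c <- keys) inc_count inc (class_pts c) (class_lines c).
Proof.
rewrite {1}/inc_count sum_by_key; apply: eq_bigr => c _.
rewrite /inc_count big_seq [RHS]big_seq; apply: eq_bigr => p hp.
rewrite /class_lines big_filter [RHS]big_mkcond; apply: eq_bigr => l _.
case: ifP => // /negbT nh; case i : (inc p l) => //.
by case/hasP: nh; exists p.
Qed.

Lemma sum_class_pts : \sum_(c <- keys) size (class_pts c) = size P.
Proof.
rewrite -(muln1 (size P)) -sum_seq_const (sum_by_key (fun=> 1%N)).
by apply: eq_bigr => c _; rewrite sum_seq_const muln1.
Qed.

(** Double counting: a line enters as many classes as its points have keys. *)
Lemma sum_class_lines B :
  (forall l, l \in L -> (size (undup [seq key p | p <- P & inc p l]) <= B)%N) ->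
  (\sum_(c <- keys) size (class_lines c) <= B * size L)%N.
Proof.
move=> h; under eq_bigr do rewrite size_filter -sum1_count big_mkcond.
rewrite exchange_big mulnC -sum_seq_const big_seq [leqRHS]big_seq; apply: leq_sum => l lL /=.
apply: leq_trans (h l lL); rewrite -big_mkcond sum1_count -size_filter.
apply: uniq_leq_size; first by rewrite filter_uniq ?undup_uniq.
move=> c; rewrite mem_filter => /andP[/hasP[p]]; rewrite mem_filter => /andP[/eqP <- pP] i _.
by rewrite mem_undup map_f // mem_filter i.
Qed.

End Classes.
End Incidences.

Lemma inc_count_swap (T U : eqType) (inc : T -> U -> bool) P L :
  inc_count inc P L = inc_count (fun l p => inc p l) L P.
Proof. exact: exchange_big. Qed.

Lemma inc_count_trivial_dual (T U : eqType) (inc : T -> U -> bool) P L :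
  linear_inc inc -> uniq P -> uniq L -> (inc_count inc P L <= size P + size L ^ 2)%N.
Proof.
move=> lin uP uL; rewrite inc_count_swap; apply: inc_count_trivial => //.
move=> l l' p p' ll' i1 i2 i3 i4; apply/eqP; apply: contraNT ll' => pp'.
by apply/eqP; apply: lin pp' i1 i3 i2 i4.
Qed.

Local Open Scope ring_scope.

(** * Barycentric subdivision and the Borsuk-Ulam theorem *)

Section Chains.
Variable V : eqType.
Implicit Types (w : seq V -> bool) (c : seq (seq V)) (t : seq V).

(** A chain over Z/2 is a list of tuples, observed only through parity sums of Boolean weights.
    Equality up to cancellation in pairs is then [chain_eq], without any quotient. *)
Definition ev w c := \big[addb/false]_(t <- c) w t.

Fixpoint bd t : seq (seq V) := if t is x :: t' then t' :: map (cons x) (bd t') else [::].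

Definition chain_eq c c' := forall w, ev w c = ev w c'.

Lemma ev_cat w c c' : ev w (c ++ c') = ev w c (+) ev w c'.
Proof. by rewrite /ev big_cat. Qed.

Lemma ev_map w (f : seq V -> seq V) c : ev w (map f c) = ev (fun t => w (f t)) c.
Proof. by rewrite /ev big_map. Qed.

Lemma ev_flatten w (F : seq V -> seq (seq V)) c :
  ev w (flatten (map F c)) = ev (fun t => ev w (F t)) c.
Proof. by rewrite /ev big_flatten big_map. Qed.

Lemma ev_cons w x t : ev w (bd (x :: t)) = w t (+) ev (fun s => w (x :: s)) (bd t).
Proof. by rewrite /ev big_cons big_map. Qed.

Lemma ev_add w w' c : ev (fun t => w t (+) w' t) c = ev w c (+) ev w' c.
Proof. by rewrite /ev big_split. Qed.

Lemma eq_ev w w' c : (forall t, t \in c -> w t = w' t) -> ev w c = ev w' c.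
Proof. by move=> h; rewrite /ev; apply: eq_big_seq. Qed.

(** By the cone formula [ev_cons], the boundary of [t] is counted twice, once for the base and once
    through the side faces. The copies cancel and leave the double boundary of [t] for the weight
    [fun s => w (x :: s)]. *)
Lemma ev_bd_bd w t : ev (fun s => ev w (bd s)) (bd t) = false.
Proof.
elim: t w => [|x t IH] w; first by rewrite /ev big_nil.
rewrite ev_cons.
have -> : ev (fun s => ev w (bd (x :: s))) (bd t) =
    ev (fun s => w s (+) ev (fun s => w (x :: s)) (bd s)) (bd t).
  by apply: eq_ev => s _; rewrite ev_cons.
by rewrite ev_add IH addbF; case: (ev _ _).
Qed.

Lemma size_bd t r : r \in bd t -> size r = (size t).-1.
Proof.
elim: t r => [//|x t IH] r; rewrite inE => /orP[/eqP -> //|/mapP[s hs ->]] /=.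
by rewrite (IH _ hs); case: t hs {IH}.
Qed.

Lemma sub_bd t r : r \in bd t -> {subset r <= t}.
Proof.
elim: t r => [//|x t IH] r; rewrite inE => /orP[/eqP -> y|/mapP[s hs ->] y].
  by rewrite inE => ->; rewrite orbT.
by rewrite !inE => /orP[->//|/(IH _ hs) ->]; rewrite orbT.
Qed.

Variable bary : seq V -> V.

(** Cone from the barycentre over the subdivided boundary. The fuel [n] stands for the size of [t],
    which drops by one on passing to a face. *)
Fixpoint sdn n t : seq (seq V) :=
  if n is n'.+1 then flatten [seq map (cons (bary t)) (sdn n' r) | r <- bd t]
  else [:: [::]].
Definition sd t := sdn (size t) t.

Lemma sdE t : t != [::] ->
  sd t = flatten [seq map (cons (bary t)) (sdn (size t).-1 r) | r <- bd t].
Proof. by case: t. Qed.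

Lemma ev_sd w t : t != [::] ->
  ev w (sd t) = ev (fun r => ev (fun s => w (bary t :: s)) (sd r)) (bd t).
Proof.
move=> t0; rewrite sdE // ev_flatten.
by apply: eq_ev => r hr; rewrite ev_map /sd (size_bd hr).
Qed.

Lemma mem_sd t s : t != [::] -> s \in sd t ->
  exists2 r, r \in bd t & exists2 s', s' \in sd r & s = bary t :: s'.
Proof.
move=> t0; rewrite sdE //; case/flattenP => q /mapP[r hr ->] /mapP[s' hs' ->].
by exists r => //; exists s' => //; rewrite /sd (size_bd hr).
Qed.

Lemma size_sd t s : s \in sd t -> size s = size t.
Proof.
move: {2}(size t) (erefl (size t)) => n; elim: n t s => [|n IH] t s.
  by move/size0nil => ->; rewrite inE => /eqP ->.
move=> st hs; have t0 : t != [::] by case: t st {hs}.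
case: (mem_sd t0 hs) => r hr [s' hs' ->] /=.
by rewrite (IH r s') ?st ?(size_bd hr) ?st.
Qed.

(* The boundary is augmented: the boundary of a singleton is the empty tuple. *)
Lemma ev_bd_sd w t :
  ev (fun s => ev w (bd s)) (sd t) = ev (fun r => ev w (sd r)) (bd t).
Proof.
move: {2}(size t) (erefl (size t)) => n; elim: n t w => [|n IH] t w.
  by move/size0nil => ->; rewrite /ev /= !big_cons !big_nil.
move=> st; have t0 : t != [::] by case: t st.
rewrite ev_sd //.
(* The boundary of a cone is its base plus the cone over the boundary of the base. The bases give
   the claim; by induction the rest is a sum over the double boundary of [t] and vanishes. *)
rewrite (eq_ev (w' := fun r => ev w (sd r) (+)
  ev (fun s => ev (fun q => ev (fun q' => w (bary t :: q')) (sd q)) (bd s)) [:: r])).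
  rewrite ev_add -[RHS]addbF; congr (_ (+) _).
  rewrite -[RHS](ev_bd_bd (fun q => ev (fun q' => w (bary t :: q')) (sd q)) t).
  by apply: eq_ev => r _; rewrite {1}/ev big_cons big_nil addbF.
move=> r hr; rewrite (eq_ev (w' := fun s => w s (+) ev (fun q => w (bary t :: q)) (bd s))).
  rewrite ev_add; congr (_ (+) _); rewrite IH; last by rewrite (size_bd hr) st.
  by rewrite [RHS]/ev big_cons big_nil addbF.
by move=> s _; rewrite ev_cons.
Qed.

Definition sdc c := flatten (map sd c).
Definition bdc c := flatten (map bd c).

Lemma sdc_eq c c' : chain_eq c c' -> chain_eq (sdc c) (sdc c').
Proof. by move=> h w; rewrite !ev_flatten h. Qed.

Lemma bdc_sdc c : chain_eq (bdc (sdc c)) (sdc (bdc c)).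
Proof.
move=> w; rewrite /bdc /sdc !ev_flatten; apply: eq_ev => t _.
exact: ev_bd_sd.
Qed.

Lemma iter_sdc_eq r c c' : chain_eq c c' -> chain_eq (iter r sdc c) (iter r sdc c').
Proof. by move=> h; elim: r => //= r IH; apply: sdc_eq. Qed.

Lemma bdc_iter_sdc r c : chain_eq (bdc (iter r sdc c)) (iter r sdc (bdc c)).
Proof.
elim: r => //= r IH w; rewrite bdc_sdc; exact: sdc_eq.
Qed.

Lemma sdc_cat c c' : sdc (c ++ c') = sdc c ++ sdc c'.
Proof. by rewrite /sdc map_cat flatten_cat. Qed.

Lemma iter_sdc_cat r c c' : iter r sdc (c ++ c') = iter r sdc c ++ iter r sdc c'.
Proof. by elim: r => //= r ->; rewrite sdc_cat. Qed.

Lemma sd_closed (P : V -> Prop) t s :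
  (forall u, u != [::] -> {subset u <= t} -> (forall x, x \in u -> P x) -> P (bary u)) ->
  (forall x, x \in t -> P x) -> s \in sd t -> forall x, x \in s -> P x.
Proof.
move: {2}(size t) (erefl (size t)) => n; elim: n t s => [|n IH] t s.
  by move/size0nil => ->; rewrite inE => _ _ /eqP ->.
move=> st hb ht hs; have t0 : t != [::] by rewrite -size_eq0 st.
case: (mem_sd t0 hs) => r hr [s' hs' ->] x; rewrite inE => /orP[/eqP ->|].
  exact: hb.
apply: (IH r s') => //; first by rewrite (size_bd hr) st.
  by move=> u u0 ur; apply: hb => // y /ur /(sub_bd hr).
by move=> y /(sub_bd hr) /ht.
Qed.

End Chains.

Section ChainMap.
Variables (V W : eqType) (f : V -> W).
Lemma bd_map t : bd (map f t) = map (map f) (bd t).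
Proof. by elim: t => //= x t ->; rewrite -!map_comp. Qed.
Lemma ev_map2 (w : seq W -> bool) (g : seq V -> seq W) c :
  ev w (map g c) = ev (fun t => w (g t)) c.
Proof. by rewrite /ev big_map. Qed.
End ChainMap.

Section ChainNeg.
Variables (V : eqType) (bary : seq V -> V) (f : V -> V).
Hypothesis fb : forall t, bary (map f t) = f (bary t).
Lemma sd_map t : sd bary (map f t) = map (map f) (sd bary t).
Proof.
rewrite /sd size_map; move: (size t) => n; elim: n t => //= n IH t.
rewrite fb bd_map -map_comp map_flatten -map_comp; congr flatten.
apply/eq_map => r /=; rewrite IH -!map_comp; exact: eq_map.
Qed.
Lemma iter_sdc_map r c :
  iter r (sdc bary) (map (map f) c) = map (map f) (iter r (sdc bary) c).
Proof.
elim: r => //= r ->; rewrite /sdc map_flatten -!map_comp; congr flatten.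
by apply/eq_map => t /=; rewrite sd_map.
Qed.
End ChainNeg.

(* A label 2j or 2j + 1 stands for +j or -j: alt_labels s l says that the labels l, sorted by
   absolute value, alternate in sign, s telling whether the first one is negative. *)
Section Alternation.

Fixpoint alt (s : bool) (l : seq bool) := if l is x :: l' then (x == s) && alt (~~ s) l' else true.

(** The parity count behind Ky Fan's argument. If the head has sign [s], deleting it asks the tail
    to alternate from [s], deleting elsewhere asks a face of the tail to alternate from [~~ s], and
    by induction two of the three resulting terms cancel. If the head has the other sign, only its
    own deletion can count. *)
Lemma alt_parity s l : l != [::] -> ev (alt s) (bd l) = alt s l (+) alt (~~ s) l.
Proof.
elim: l s => [//|x l IH] s _; rewrite ev_cons.
have [->|l0] := eqVneq l [::]; first by rewrite /ev big_nil /=; case: x; case: s.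
rewrite (eq_ev (w' := fun r => (x == s) && alt (~~ s) r)) // [alt s (x :: l)]/= [alt (~~ s) (x :: l)]/=.
case: (eqVneq x s) => [->|xs].
  rewrite (eq_ev (w' := alt (~~ s))) // IH // !negbK.
  by case: (s) (alt _ l) (alt _ l) => [] [] [].
have -> : x == ~~ s by case: (x) (s) xs => [] [].
by rewrite negbK {1}/ev big1_eq addbF.
Qed.

Definition alt_labels s (l : seq nat) := alt s (map odd (sort leq l)).

Lemma alt_labels_perm s l l' : perm_eq l l' -> alt_labels s l = alt_labels s l'.
Proof.
by move=> h; rewrite /alt_labels (perm_sortP leq_total leq_trans anti_leq l l' h).
Qed.

Lemma ev_bd_rem (w : seq nat -> bool) l :
  (forall l1 l2, perm_eq l1 l2 -> w l1 = w l2) ->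
  ev w (bd l) = \big[addb/false]_(x <- l) w (rem x l).
Proof.
elim: l w => [|x l IH] w hw; first by rewrite /ev !big_nil.
rewrite ev_cons big_cons /= eqxx; congr (_ (+) _).
rewrite IH; last by move=> l1 l2 h; apply: hw; rewrite perm_cons.
apply: eq_big_seq => y yl; apply: hw; case: eqVneq => [->|//].
by rewrite perm_sym perm_to_rem.
Qed.

Lemma ev_bd_perm w (l l' : seq nat) :
  (forall l1 l2, perm_eq l1 l2 -> w l1 = w l2) -> perm_eq l l' ->
  ev w (bd l) = ev w (bd l').
Proof.
move=> hw hl; rewrite !ev_bd_rem //.
rewrite (perm_big _ hl); apply: eq_big_seq => x xl'; apply: hw.
have xl : x \in l by rewrite (perm_mem hl).
rewrite -(perm_cons x); apply: perm_trans (_ : perm_eq l' _).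
  by rewrite perm_sym; apply: perm_trans (perm_to_rem xl); rewrite perm_sym.
exact: perm_to_rem.
Qed.

Lemma subseq_bd (l r : seq nat) : r \in bd l -> subseq r l.
Proof.
elim: l r => [//|x l IH] r; rewrite inE => /orP[/eqP ->|/mapP[s hs ->]].
  exact: subseq_cons.
by rewrite /= eqxx IH.
Qed.

(** The weight is invariant under permutations, so the labels may be sorted first; faces of a sorted
    list stay sorted, which leaves [alt_parity]. *)
Lemma alt_labels_parity s l : l != [::] -> ev (alt_labels s) (bd l) = alt_labels s l (+) alt_labels (~~ s) l.
Proof.
move=> l0; rewrite (ev_bd_perm (l' := sort leq l)); last first.
- by rewrite perm_sym perm_sort.
- exact: alt_labels_perm.
rewrite /alt_labels -alt_parity; last first.
  by rewrite -size_eq0 size_map size_sort size_eq0.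
rewrite bd_map ev_map2; apply: eq_ev => r hr; congr (alt _ (map _ _)).
apply: (sorted_sort leq_trans); apply: (subseq_sorted leq_trans (subseq_bd hr)).
exact: sort_sorted leq_total _.
Qed.

Definition flip (n : nat) := if odd n then n.-1 else n.+1.

Definition no_compl (l : seq nat) := forall x y, x \in l -> y \in l -> x./2 = y./2 -> x = y.

(** Flipping moves a label only within its pair 2j, 2j + 1, and distinct labels lie in distinct
    pairs, so it commutes with sorting; it changes every parity. *)
Lemma alt_labels_flip s l : no_compl l -> alt_labels s (map flip l) = alt_labels (~~ s) l.
Proof.
move=> nc; rewrite /alt_labels.
have -> : sort leq (map flip l) = map flip (sort leq l).
  have h : perm_eq (map flip l) (map flip (sort leq l)).
    by apply: perm_map; rewrite perm_sym perm_sort.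
  rewrite (perm_sortP leq_total leq_trans anti_leq _ _ h).
  apply: (sorted_sort leq_trans).
  have := sort_sorted leq_total l; rewrite sorted_map.
  apply: (@sub_in_sorted _ (mem l)) => [x y|]; last by apply/allP => x; rewrite mem_sort.
  move=> xl yl /= xy.
  case: (x =P y) => [->//|xny]; have hh : x./2 <> y./2 by move=> e; apply: xny; apply: nc.
  rewrite /flip; have := odd_double_half x; have := odd_double_half y.
  by case: (odd x); case: (odd y) => /=; lia.
rewrite -map_comp.
elim: (sort leq l) s {nc} => //= x m IH s; rewrite IH; congr (_ && _).
have -> : odd (flip x) = ~~ odd x.
  by rewrite /flip; case: ifP; case: x => //= x; case: (odd x).
by case: (odd x) s => [] [].
Qed.

(** Equal labels have equal signs, so consecutive labels of a sorted alternating list differ.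
    Without opposite labels their absolute values increase strictly, and only [N] values are
    available. *)
Lemma alt_bound N l s : (size l > N)%N -> (forall x, x \in l -> x < N.*2)%N -> alt_labels s l ->
  ~ no_compl l.
Proof.
rewrite /alt_labels => sl hl; have : perm_eq l (sort leq l) by rewrite perm_sym perm_sort.
move: (sort leq l) (sort_sorted leq_total l) => m ms pm hm nc.
have {}sl : (size m > N)%N by rewrite -(perm_size pm).
have {}hl : (forall x, x \in m -> x < N.*2)%N by move=> x; rewrite -(perm_mem pm); exact: hl.
have {}nc : no_compl m by move=> x y; rewrite -!(perm_mem pm); exact: nc.
have : forall k, (k <= head 0%N m)%N -> (size m > N - k./2)%N -> False; last first.
  by move=> /(_ 0%N (leq0n _)); rewrite subn0; apply.
move: {pm l}N hl {sl} => N.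
elim: m s ms hm nc => [//|x m IH] s ms /= /andP[/eqP xs hm] nc hN k kx.
have xN := hN x (mem_head _ _).
have k2 : (k./2 <= x./2)%N by apply: half_leq.
have xN2 : (x./2 < N)%N by have := odd_double_half x; lia.
case: m IH ms hm nc hN => [_ _ _ _ _|y m IH ms hm nc hN]; first by rewrite /=; lia.
have xy : (x <= y)%N by move: ms => /= /andP[].
have hy : (x./2 < y./2)%N.
  have : x <> y.
    by move=> exy; move: hm; rewrite /= -exy xs => /andP[/eqP]; case: (s).
  have : (x./2 <= y./2)%N by apply: half_leq.
  rewrite leq_eqVlt => /orP[/eqP e|//]; case.
  by apply: nc => //; rewrite !inE ?eqxx ?orbT.
move=> sz; apply: (IH _ _ hm _ _ (y./2).*2).
- by move: ms => /= /andP[].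
- by move=> a b ha hb; apply: nc; rewrite inE ?ha ?hb orbT.
- by move=> z hz; apply: hN; rewrite inE hz orbT.
- by rewrite /=; have := odd_double_half y; lia.
- move: sz; rewrite /= doubleK; lia.
Qed.

End Alternation.

Lemma ler_sum_seq (R : numDomainType) (T : eqType) (r : seq T) (F G : T -> R) :
  (forall x, x \in r -> F x <= G x) -> \sum_(x <- r) F x <= \sum_(x <- r) G x.
Proof.
by move=> h; rewrite big_seq_cond [leRHS]big_seq_cond; apply: ler_sum => x /andP[/h].
Qed.

(** * The crosspolytope, its subdivisions and an approximate Borsuk-Ulam theorem *)

Section BorsukUlam.
Variables (R : realType) (N : nat).
Local Notation V := 'rV[R]_N.+1.
Implicit Types (t : seq V) (i : 'I_N.+1).

Definition bary (t : seq V) : V := (size t)%:R^-1 *: \sum_(x <- t) x.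

Lemma bary_opp t : bary (map -%R t) = - bary t.
Proof. by rewrite /bary size_map big_map sumrN scalerN. Qed.

Definition basis_pt k : V := delta_mx 0 (inord k).

(* oc k is the crosspolytope sphere of dimension k - 1, hc k a hemisphere of dimension k. *)
Fixpoint oc k : seq (seq V) :=
  if k is k'.+1 then map (cons (basis_pt k')) (oc k') ++ map (cons (- basis_pt k')) (oc k')
  else [:: [::]].
Definition hc k := map (cons (basis_pt k)) (oc k).
Definition nu (c : seq (seq V)) := map (map -%R) c.

Lemma ev_bdc_cons w x (c : seq (seq V)) :
  ev w (bdc (map (cons x) c)) = ev w c (+) ev (fun s => w (x :: s)) (bdc c).
Proof.
rewrite /bdc !ev_flatten ev_map -ev_add; apply: eq_ev => t _; exact: ev_cons.
Qed.

Lemma bdc_oc k : chain_eq (bdc (oc k)) [::].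
Proof.
elim: k => [|k IH] w; first by rewrite /bdc /= /ev big_nil.
rewrite /= /bdc map_cat flatten_cat -!/(bdc _) ev_cat !ev_bdc_cons !IH.
by rewrite /ev !big_nil !addbF addbb.
Qed.

Lemma nu_oc k : chain_eq (nu (oc k)) (oc k).
Proof.
elim: k => [//|k IH] w; rewrite /= /nu map_cat !ev_cat addbC.
have aux x : ev w (map (map -%R) (map (cons x) (oc k))) = ev w (map (cons (- x)) (oc k)).
  rewrite ev_map ev_map [RHS]ev_map -[RHS]IH [RHS]ev_map; exact: eq_ev.
by rewrite !aux opprK.
Qed.

Lemma bdc_hc k : chain_eq (bdc (hc k)) (oc k).
Proof. by move=> w; rewrite ev_bdc_cons bdc_oc /ev big_nil addbF. Qed.

(** The base [oc k] is antipodally symmetric modulo 2, so the second cone is the antipode of the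
    first. *)
Lemma oc_hc k : chain_eq (oc k.+1) (hc k ++ nu (hc k)).
Proof.
move=> w; rewrite /= !ev_cat; congr (_ (+) _).
rewrite [RHS]ev_map [RHS]ev_map [LHS]ev_map -[LHS]nu_oc [LHS]ev_map; exact: eq_ev.
Qed.

Lemma oc_vertex k t x : t \in oc k -> x \in t -> exists2 j, (j < k)%N & x = basis_pt j \/ x = - basis_pt j.
Proof.
elim: k t => [t|k IH t]; first by rewrite inE => /eqP ->.
rewrite /= mem_cat => /orP[] /mapP[s hs ->]; rewrite inE => /orP[/eqP ->|xs];
 try (by exists k; auto); by case: (IH _ hs xs) => j jk h; exists j => //; apply: ltnW.
Qed.

Lemma size_oc k t : t \in oc k -> size t = k.
Proof.
elim: k t => [t|k IH t]; first by rewrite inE => /eqP ->.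
by rewrite /= mem_cat => /orP[] /mapP[s hs ->] /=; rewrite (IH _ hs).
Qed.

(** The hyperplane of the crosspolytope facet with signs [eps], cut by the unit cube. It may be
    larger than the facet, but it is convex, so barycentres stay in it, and it forces the absolute
    coordinates to sum to at least 1. *)
Definition facet (eps : 'I_N.+1 -> bool) (x : V) :=
  \sum_i (-1) ^+ eps i * x 0 i = 1 /\ forall i, `|x 0 i| <= 1.

Lemma sum_bary (f : V -> R) (c : R) t :
  (forall a (x y : V), f (a *: x + y) = a * f x + f y) -> t != [::] ->
  (forall x, x \in t -> f x = c) -> f (bary t) = c.
Proof.
move=> fl t0 ft.
have f0 : f 0 = 0 by have := fl (-1) 0 0; rewrite scaler0 addr0 => h; lra.
have -> : f (bary t) = (size t)%:R^-1 * \sum_(x <- t) f x.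
  rewrite /bary -[_ *: _]addr0 fl f0 addr0; congr (_ * _).
  elim: (t) => [|x u IH]; first by rewrite !big_nil.
  by rewrite !big_cons -[x]scale1r fl mul1r scale1r IH.
rewrite (eq_big_seq (fun=> c)) // big_const_seq count_predT iter_addr addr0 -[c *+ _]mulr_natl.
by rewrite mulrA mulVf ?mul1r // pnatr_eq0 size_eq0.
Qed.

Lemma bary_itv (lo hi : R) i t : t != [::] ->
  (forall x, x \in t -> lo <= x 0 i <= hi) -> lo <= bary t 0 i <= hi.
Proof.
move=> t0 ht; rewrite /bary mxE summxE.
have n0 : 0 < (size t)%:R :> R by rewrite ltr0n lt0n size_eq0.
have cst c : \sum_(x <- t) c = c * (size t)%:R :> R.
  by rewrite big_const_seq count_predT iter_addr addr0 mulr_natr.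
rewrite mulrC ler_pdivlMr // ler_pdivrMr // -!cst.
by apply/andP; split; apply: ler_sum_seq => x xt; case/andP: (ht x xt).
Qed.

Lemma facet_bary eps t : t != [::] -> (forall x, x \in t -> facet eps x) -> facet eps (bary t).
Proof.
move=> t0 ht; split.
  apply: (@sum_bary (fun x => \sum_i (-1) ^+ eps i * x 0 i)) => // [a x y|x /ht[]//].
  by rewrite mulr_sumr -big_split; apply: eq_bigr => i _; rewrite !mxE /=; ring.
move=> i; rewrite ler_norml; apply: bary_itv => // x /ht[_ /(_ i)].
by rewrite ler_norml.
Qed.

Lemma facet_oc k t : (k <= N.+1)%N -> t \in oc k -> exists eps, forall x, x \in t -> facet eps x.
Proof.
elim: k t => [t _|k IH t kN]; first by rewrite inE => /eqP ->; exists (fun=> false).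
have dE k' (j : 'I_N.+1) : basis_pt k' 0 j = (j == inord k')%:R by rewrite mxE eqxx.
have key s (b : bool) : s \in oc k -> exists eps, forall x, x \in (-1) ^+ b *: basis_pt k :: s -> facet eps x.
  move=> hs; case: (IH s (ltnW kN) hs) => eps heps.
  exists (fun i => if i == inord k then b else eps i) => x; rewrite inE => /orP[/eqP ->|xs].
    split=> [|i].
      rewrite (bigD1 (inord k)) //= eqxx mxE dE eqxx mulr1 -signr_addb addbb big1 ?addr0 ?expr0//.
      by move=> i /negbTE ik; rewrite mxE dE ik !mulr0.
    by rewrite mxE dE normrM normrX normrN1 expr1n mul1r; case: eqP; rewrite ?normr1 ?normr0.
  case: (heps _ xs) => h1 h2; split => //; rewrite -[RHS]h1.
  apply: eq_bigr => i _; case: eqP => // ->.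
  case: (oc_vertex hs xs) => j jk hj.
  suff -> : x 0 (inord k) = 0 by rewrite !mulr0.
  have nkj : (inord k == inord j :> 'I_N.+1) = false.
    by apply/eqP => /(congr1 val); rewrite /= !inordK //; lia.
  by case: hj => ->; [|rewrite mxE]; rewrite dE nkj ?oppr0.
rewrite /= mem_cat => /orP[] /mapP[s hs ->].
  by have [eps h] := key s false hs; exists eps => x; have := h x; rewrite expr0 scale1r.
by have [eps h] := key s true hs; exists eps => x; have := h x; rewrite expr1 scaleN1r.
Qed.

Lemma hc_sub_oc k t : t \in hc k -> t \in oc k.+1.
Proof. by rewrite /= mem_cat => ->. Qed.

Lemma facet_iter r k t : (k < N.+1)%N -> t \in iter r (sdc bary) (hc k) ->
  exists eps, forall x, x \in t -> facet eps x.
Proof.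
move=> kN; elim: r t => [t /hc_sub_oc|r IH t]; first exact: facet_oc.
rewrite iterS => /flattenP[c /mapP[s hs ->] ht].
case: (IH s hs) => eps heps; exists eps.
apply: (@sd_closed _ bary (facet eps) s t) => // u u0 _; exact: facet_bary.
Qed.

Lemma size_iter r k t : t \in iter r (sdc bary) (hc k) -> size t = k.+1.
Proof.
elim: r t => [t /mapP[s /size_oc hs ->]|r IH t]; first by rewrite /= hs.
by rewrite iterS => /flattenP[c /mapP[s hs ->] /size_sd ->]; apply: IH.
Qed.

Definition mesh (d : R) (t : seq V) :=
  forall x y, x \in t -> y \in t -> forall i, `|x 0 i - y 0 i| <= d.

Definition theta : R := N%:R / N.+1%:R.

(** In each coordinate, the barycentre of k points differs from any of them by at most (k - 1)/k
    times [d], because one of the averaged differences is zero; for k at most N + 1 this factor is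
    at most [theta]. The remaining edges come from the subdivided boundary. *)
Lemma mesh_sd d t s : 0 <= d -> (size t <= N.+1)%N -> mesh d t -> s \in sd bary t -> mesh (theta * d) s.
Proof.
move=> d0; move: {2}(size t) (erefl (size t)) => n; elim: n t s => [|n IH] t s.
  by move/size0nil => ->; rewrite inE => _ _ /eqP ->.
move=> st tN mt hs; have t0 : t != [::] by rewrite -size_eq0 st.
case: (mem_sd t0 hs) => r hr [s' hs' es].
have th0 : 0 <= theta by rewrite divr_ge0.
have ms' : mesh (theta * d) s'.
  apply: (IH r s') => //; first by rewrite (size_bd hr) st.
    by rewrite (size_bd hr); apply: leq_trans (leq_pred _) tN.
  by move=> x y /(sub_bd hr) xt /(sub_bd hr) yt; apply: mt.
have bt x i : x \in t -> `|bary t 0 i - x 0 i| <= theta * d.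
  move=> xt; have n0 : 0 < (size t)%:R :> R by rewrite ltr0n lt0n size_eq0.
  have -> : bary t 0 i - x 0 i = (size t)%:R^-1 * \sum_(y <- rem x t) (y 0 i - x 0 i).
    have -> : \sum_(y <- rem x t) (y 0 i - x 0 i) = \sum_(y <- t) (y 0 i - x 0 i).
      by rewrite [RHS](perm_big _ (perm_to_rem xt)) big_cons /= subrr add0r.
    rewrite big_split /= sumrN big_const_seq count_predT iter_addr addr0 /bary mxE summxE.
    by rewrite mulrDr -[x 0 i *+ _]mulr_natl mulrN mulrA mulVf ?mul1r // gt_eqF.
  rewrite normrM gtr0_norm ?invr_gt0 // mulrC ler_pdivrMr //.
  apply: le_trans (ler_norm_sum _ _ _) _.
  apply: le_trans (_ : \sum_(y <- rem x t) d <= _).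
    apply: ler_sum_seq => y yt; apply: mt => //; exact: mem_rem yt.
  rewrite big_const_seq count_predT iter_addr addr0 -[d *+ _]mulr_natl mulrAC.
  apply: ler_wpM2r => //; rewrite size_rem // st /= /theta.
  rewrite mulrAC ler_pdivlMr ?ltr0n // -!natrM ler_nat.
  by move: tN; rewrite st; nia.
have bs' y i : y \in s' -> `|bary t 0 i - y 0 i| <= theta * d.
  move=> ys; apply: (@sd_closed _ bary (fun y : V => `|bary t 0 i - y 0 i| <= theta * d) r s') => //.
    move=> u u0 _ hu; rewrite ler_distlC; apply: bary_itv => // z /hu.
    by rewrite ler_distlC.
  by move=> z /(sub_bd hr); apply: bt.
move=> x y; rewrite es !inE => /orP[/eqP ->|xs] /orP[/eqP ->|ys] i.
- by rewrite subrr normr0 mulr_ge0.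
- exact: bs'.
- by rewrite distrC; apply: bs'.
- exact: ms'.
Qed.

Lemma mesh_iter r k t : (k < N.+1)%N -> t \in iter r (sdc bary) (hc k) -> mesh (theta ^+ r * 2) t.
Proof.
move=> kN; elim: r t => [t ht|r IH t].
  have [eps heps] := @facet_iter 0 k t kN ht.
  move=> x y /heps[_ hx] /heps[_ hy] i; rewrite expr0 mul1r.
  apply: le_trans (ler_normB _ _) _; have := hx i; have := hy i; lra.
rewrite iterS => /flattenP[c /mapP[s hs ->] ht].
rewrite exprS -mulrA; apply: (mesh_sd _ _ (IH s hs)) => //.
  by rewrite mulr_ge0 // exprn_ge0 // divr_ge0.
by rewrite (size_iter hs).
Qed.

Lemma theta_small (eta : R) : 0 < eta -> exists r, theta ^+ r * 2 <= eta.
Proof.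
move=> e0; have th : `|theta| < 1.
  by rewrite ger0_norm ?divr_ge0 // /theta ltr_pdivrMr ?ltr0n // mul1r ltr_nat.
have /cvgrPdist_le /(_ (eta / 2) (divr_gt0 e0 (ltr0Sn _ _))) [r _ /(_ r (leqnn r))] := cvg_expr th.
rewrite /= sub0r normrN ger0_norm; last by rewrite exprn_ge0 // divr_ge0.
by move=> h; exists r; rewrite -ler_pdivlMr // ltr0n.
Qed.

Section Labelling.
Variables (lam : V -> nat) (r : nat).
Hypothesis lamN : forall eps x, facet eps x -> lam (- x) = flip (lam x).
Local Notation chain k := (iter r (sdc bary) (hc k)).
Hypothesis nc : forall k t, (k < N.+1)%N -> t \in chain k -> no_compl (map lam t).

Definition wt s (t : seq V) := alt_labels s (map lam t).

Lemma wt_parity s (c : seq (seq V)) : (forall t, t \in c -> t != [::]) ->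
  ev (wt s) c (+) ev (wt (~~ s)) c = ev (wt s) (bdc c).
Proof.
move=> hc0; rewrite -ev_add /bdc ev_flatten; apply: eq_ev => t tc.
rewrite /wt -alt_labels_parity; last by rewrite -size_eq0 size_map size_eq0 hc0.
by rewrite bd_map ev_map2.
Qed.

(** By [wt_parity] the count equals one over the boundary, which is a subdivided sphere, that is, a
    hemisphere of one dimension less together with its antipode. The antipode exchanges the leading
    sign, so the induction hypothesis appears. The start is the empty tuple, the boundary of a
    point. *)
Lemma chain_odd k : (k < N.+1)%N -> ev (wt true) (chain k) (+) ev (wt false) (chain k) = true.
Proof.
have ne k' t : t \in chain k' -> t != [::] by move/size_iter; case: t.
elim: k => [|k IH] kN; rewrite (wt_parity true); try exact: ne.
  rewrite bdc_iter_sdc (@iter_sdc_eq _ _ r _ _ (bdc_hc 0)) /=.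
  suff -> : iter r (sdc bary) [:: [::]] = [:: [::]] by rewrite /ev big_cons big_nil.
  by elim: r => //= r' ->.
rewrite bdc_iter_sdc (@iter_sdc_eq _ _ r _ _ (bdc_hc k.+1)).
rewrite (@iter_sdc_eq _ _ r _ _ (oc_hc k)) iter_sdc_cat ev_cat -[RHS](IH (ltnW kN)).
congr (_ (+) _); rewrite /nu (iter_sdc_map bary_opp) ev_map; apply: eq_ev => t tc.
rewrite /wt -map_comp.
have -> : map (lam \o -%R) t = map flip (map lam t).
  rewrite -map_comp; apply/eq_in_map => x xt /=.
  by have [eps he] := facet_iter (ltnW kN) tc; apply: lamN (he _ xt).
by rewrite alt_labels_flip //; apply: nc tc; apply: ltnW.
Qed.

(** A tuple of the subdivided [hc N] has [N.+1] vertices, so with labels below [N.*2] none can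
    alternate by [alt_bound], while [chain_odd] makes their number odd. *)
Lemma labels_large : exists eps x, facet eps x /\ (N.*2 <= lam x)%N.
Proof.
apply: contrapT => hno.
have lb t x : t \in chain N -> x \in t -> (lam x < N.*2)%N.
  move=> tc xt; rewrite ltnNge; apply/negP => h; apply: hno.
  by have [eps he] := facet_iter (ltnSn N) tc; exists eps, x; split => //; apply: he.
have nall s t : t \in chain N -> wt s t = false.
  move=> tc; apply/negP; move/(alt_bound (N := N)) => H; apply: (H _ _ (nc (ltnSn N) tc)).
    by rewrite size_map (size_iter tc).
  by move=> _ /mapP[x xt ->]; apply: lb tc xt.
have := chain_odd (ltnSn N).
by rewrite (@eq_ev _ _ (fun=> false)) ?(@eq_ev _ (wt false) (fun=> false)) /ev ?big1_eq //; apply: nall.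
Qed.
End Labelling.

(** Without such a point, every facet point has a label: an index [j] with [g j x] above 1/2 in
    absolute value, and the sign of [g j x]. Oddness makes the labelling antipodal, and opposite
    labels in one small simplex would force a jump above 1. All labels are below [N.*2], against
    [labels_large]. *)
Lemma borsuk_ulam (g : 'I_N -> V -> R) (eta : R) : 0 < eta ->
  (forall j x, g j (- x) = - g j x) ->
  (forall j (x y : V), (forall i, `|x 0 i - y 0 i| <= eta) -> `|g j x - g j y| <= 1) ->
  exists x : V, [/\ forall i, `|x 0 i| <= 1, 1 <= \sum_i `|x 0 i| & forall j, `|g j x| <= 2^-1].
Proof.
move=> e0 gN gL; apply: contrapT => hno.
have [r hr] := theta_small e0.
have fpt eps x : facet eps x -> exists j, 2^-1 < `|g j x|.
  case=> h1 h2; apply: contrapT => h; apply: hno; exists x; split => //.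
    rewrite -h1; apply: ler_sum => i _; apply: le_trans (ler_norm _) _.
    by rewrite normrM normrX normrN1 expr1n mul1r.
  by move=> j; rewrite leNgt; apply/negP => hj; apply: h; exists j.
pose big x := [pred j | 2^-1 < `|g j x|].
pose lam x := if [pick j | big x j] is Some j then (j.*2 + (g j x < 0)%R)%N else N.*2.
have bigN x : big (- x) =1 big x by move=> j; rewrite /= gN normrN.
have lamE eps x : facet eps x -> exists2 j, big x j & lam x = (j.*2 + (g j x < 0)%R)%N.
  move=> /fpt[j0 hj0]; rewrite /lam; case: pickP => [j hj|/(_ j0)]; first by exists j.
  by rewrite /= hj0.
have [||eps [x [fx]]] := @labels_large lam r.
- move=> eps x /fpt[j0 hj0]; rewrite /lam (eq_pick (bigN x)).
  case: pickP => [j /= hj|/(_ j0)]; last by rewrite /= hj0.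
  have gj0 : g j x != 0 by apply: contraL hj => /eqP ->; rewrite normr0 -leNgt invr_ge0.
  rewrite gN oppr_lt0 /flip; case: (ltgtP (g j x) 0) gj0 => //= _ _.
    by rewrite addn1 addn0 oddS odd_double.
  by rewrite addn1 addn0 odd_double.
- move=> k t kN tc _ _ /mapP[x xt ->] /mapP[y yt ->].
  have [eps he] := facet_iter kN tc.
  have [j /= hj ->] := lamE _ _ (he _ xt); have [j' /= hj' ->] := lamE _ _ (he _ yt).
  have half (i : nat) (b : bool) : (i.*2 + b)./2 = i by rewrite addnC half_bit_double.
  rewrite !half => /val_inj ejj; rewrite -{}ejj in hj' *.
  have /(gL j) : forall i, `|x 0 i - y 0 i| <= eta.
    by move=> i; apply: le_trans hr; exact: (mesh_iter kN tc xt yt).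
  move: hj hj'; case: (ltP (g j x) 0) => hx; case: (ltP (g j y) 0) => hy //; rewrite ?(ltr0_norm hx) ?(ltr0_norm hy)
    ?(ger0_norm hx) ?(ger0_norm hy) => h1 h2; rewrite ler_norml => /andP[? ?]; exfalso; lra.
have [j _ ->] := lamE _ _ fx.
have := ltn_ord j; case: (_ < 0); lia.
Qed.

End BorsukUlam.

(** * Polynomial partitioning *)

Section HamSandwich.
Import numFieldNormedType.Exports.
Variables (R : realType) (T : eqType).

Lemma pos_gap (s : seq T) (f : T -> R) :
  exists2 d, 0 < d & forall p, p \in s -> 0 < f p -> d <= f p.
Proof.
elim: s => [|p s [d d0 hd]]; first by exists 1.
have [fp|fp] := ltP 0 (f p).
  exists (Num.min d (f p)) => [|q]; first by rewrite lt_min d0 fp.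
  by rewrite inE => /orP[/eqP -> _|qs fq]; rewrite ge_min ?lexx ?orbT // hd.
exists d => // q; rewrite inE => /orP[/eqP ->|qs]; last exact: hd.
by rewrite ltNge fp.
Qed.

(** A continuous odd substitute for the sign, with which it agrees where the argument is at least 1
    in absolute value. *)
Definition clip (z : R) := Num.max (-1) (Num.min 1 z).

Lemma clipN z : clip (- z) = - clip z.
Proof. by rewrite /clip oppr_max opprK oppr_min maxEle minEle !minElt !maxElt; do ! case: ifP; lra. Qed.

Lemma clip_lip y z : `|clip y - clip z| <= `|y - z|.
Proof.
rewrite /clip !maxEle !minEle.
by do ! case: ifP; move=> *; rewrite ler_norml; case: (ler0P (y - z)); lra.
Qed.

Lemma clip_ge z : -1 <= clip z. Proof. by rewrite le_max lexx. Qed.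
Lemma clip1 z : 1 <= z -> clip z = 1.
Proof. by move=> z1; rewrite /clip min_l // max_r //; lra. Qed.

Variables (N : nat) (S : 'I_N -> seq T) (phi : 'I_N.+1 -> T -> R).
Local Notation V := 'rV[R]_N.+1.
Definition lincomb (x : V) p := \sum_i x 0 i * phi i p.
Let M : R := 1 + \sum_j \sum_(p <- S j) \sum_i `|phi i p|.

Let M1 : 1 <= M.
Proof. by rewrite lerDl; apply: sumr_ge0 => j _; apply: sumr_ge0 => p _; apply: sumr_ge0. Qed.

Lemma lincomb_lip (x y : V) p e : (forall i, `|x 0 i - y 0 i| <= e) ->
  `|lincomb x p - lincomb y p| <= e * \sum_i `|phi i p|.
Proof.
move=> h; rewrite /lincomb -sumrB mulr_sumr.
apply: le_trans (ler_norm_sum _ _ _) _; apply: ler_sum => i _.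
by rewrite -mulrBl normrM ler_wpM2r.
Qed.

Lemma approx_ham_sandwich (k : nat) : exists x : V,
  [/\ forall i, `|x 0 i| <= 1, 1 <= \sum_i `|x 0 i| &
   forall j, `|\sum_(p <- S j) clip (k%:R * lincomb x p)| <= 2^-1].
Proof.
(* The constant [M] dominates the sum of all [phi i p] in absolute value over each [S j]; a change
   of [x] by this step therefore changes every clipped sum by at most 1. *)
apply: (@borsuk_ulam R N (fun j x => \sum_(p <- S j) clip (k%:R * lincomb x p)) (k.+1%:R * M)^-1).
- by rewrite invr_gt0 mulr_gt0 // (lt_le_trans ltr01).
- move=> j x; rewrite -sumrN; apply: eq_bigr => p _; rewrite -clipN -mulrN; congr (clip (_ * _)).
  by rewrite /lincomb -sumrN; apply: eq_bigr => i _; rewrite mxE mulNr.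
- move=> j x y hxy; rewrite -sumrB; apply: le_trans (ler_norm_sum _ _ _) _.
  apply: (@le_trans _ _ (\sum_(p <- S j) k%:R * ((k.+1%:R * M)^-1 * \sum_i `|phi i p|))).
    apply: ler_sum => p _; apply: le_trans (clip_lip _ _) _.
    rewrite -mulrBr normrM normr_nat ler_wpM2l //; exact: lincomb_lip.
  rewrite -mulr_sumr -mulr_sumr.
  have hM : \sum_(p <- S j) \sum_i `|phi i p| <= M.
    rewrite /M (bigD1 j) //= addrCA lerDl addr_ge0 //.
    by apply: sumr_ge0 => j' _; apply: sumr_ge0 => p _; apply: sumr_ge0.
  have M0 : 0 < M by rewrite (lt_le_trans ltr01).
  rewrite invfM mulrA [_ * (_ * M^-1)]mulrA -mulrA; apply: mulr_ile1.
  - by rewrite divr_ge0.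
  - by rewrite mulr_ge0 ?invr_ge0 ?(ltW M0) //; apply: sumr_ge0 => p _; apply: sumr_ge0.
  - by rewrite ler_pdivrMr ?ltr0n // mul1r ler_nat.
  - by rewrite mulrC ler_pdivrMr // mul1r.
Qed.

(** The solution is a cluster point [x] of the approximate solutions [u k] in the cube; the lower
    bound on their absolute coordinates keeps it nonzero. For a suitable large [k], the points
    positive at [x] have clipped value 1 under [u k] and all others at least -1. So twice the count
    exceeds the size by at most 1/2, hence not at all, both being integers. *)
Lemma ham_sandwich : exists x : V, x != 0 /\ forall j,
  ((count (fun p => 0 < lincomb x p)%R (S j)).*2 <= size (S j))%N /\
  ((count (fun p => lincomb x p < 0)%R (S j)).*2 <= size (S j))%N.
Proof.
have [u hu] := choice approx_ham_sandwich.
have cK : compact [set v : V | forall i, `[(-1 : R), 1]%classic (v 0 i)].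
  by apply: (@rV_compact R N.+1 (fun=> `[(-1 : R), 1]%classic)) => i; apply: segment_compact.
have [|x [_ xcl]] := cK (u @ \oo)%classic _.
  by exists 0%N => // k _ i /=; rewrite in_itv /= -ler_norml; case: (hu k).
have near (e : R) k0 : 0 < e -> exists2 k, (k0 <= k)%N & forall i, `|x 0 i - u k 0 i| < e.
  move=> e0; have [||y [[k hk <-] hb]] := xcl [set u k | k in [set k | (k0 <= k)%N]]%classic (ball x e).
  - exists k0 => // k /= hk; by exists k.
  - exact: nbhsx_ballx.
  by exists k => // i; case: hb => _ /(_ 0 i).
have x0 : x != 0.
  apply/eqP => x0; have e0 : 0 < (N.+1%:R : R)^-1 by rewrite invr_gt0 ltr0n.
  have [k _ hk] := near _ 0%N e0; have [_ h _] := hu k.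
  suff : \sum_i `|u k 0 i| < 1 by rewrite ltNge h.
  have -> : 1 = \sum_(i < N.+1) (N.+1%:R : R)^-1.
    by rewrite sumr_const card_ord -[_^-1 *+ _]mulr_natl divff // pnatr_eq0.
  apply: ltr_sum => [|i _]; first by apply/hasP; exists ord0; rewrite ?mem_index_enum.
  by have := hk i; rewrite x0 mxE sub0r normrN.
exists x; split => // j.
have half (s : bool) : ((count (fun p => 0 < (-1) ^+ s * lincomb x p)%R (S j)).*2 <= size (S j))%N.
  have [d d0 hd] := pos_gap (S j) (fun p => (-1) ^+ s * lincomb x p).
  pose M' := 1 + \sum_(p <- S j) \sum_i `|phi i p|.
  have M0 : 0 < M'.
    by rewrite ltr_pwDl //; apply: sumr_ge0 => p _; apply: sumr_ge0.
  (* Since [d] bounds the positive values from below, a shift under [d / 2 / M'] keeps them at least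
     [d / 2], and [k] at least [2 / d] then clips them to 1. *)
  have [k hk hx] := near (d / 2 / M') (Num.truncn (2 / d)).+1 (divr_gt0 (divr_gt0 d0 (ltr0Sn _ 1)) M0).
  have [_ _ /(_ j)] := hu k.
  have k2 : 2 / d <= k%:R.
    apply: ltW; apply: lt_le_trans (_ : (Num.truncn (2 / d)).+1%:R <= _); last by rewrite ler_nat.
    by apply: truncnS_gt.
  move=> hk2.
  have {hk2} : \sum_(p <- S j) clip ((-1) ^+ s * (k%:R * lincomb (u k) p)) <= 2^-1.
    have -> : \sum_(p <- S j) clip ((-1) ^+ s * (k%:R * lincomb (u k) p)) =
        (-1) ^+ s * \sum_(p <- S j) clip (k%:R * lincomb (u k) p).
      rewrite mulr_sumr; apply: eq_bigr => p _.
      by case: (s); rewrite ?expr0 ?expr1 ?mul1r // !mulN1r clipN.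
    apply: le_trans (ler_norm _) _; apply: le_trans hk2.
    by rewrite normrM normrX normrN1 expr1n mul1r.
  have low : ((count (fun p => 0 < (-1) ^+ s * lincomb x p)%R (S j)).*2%:R - (size (S j))%:R <= 
    \sum_(p <- S j) clip ((-1) ^+ s * (k%:R * lincomb (u k) p))).
    have -> : (count (fun p => 0 < (-1) ^+ s * lincomb x p)%R (S j)).*2%:R - (size (S j))%:R =
      \sum_(p <- S j) (2 * (0 < (-1) ^+ s * lincomb x p)%R%:R - 1) :> R.
      elim: (S j) => [|p q IH]; first by rewrite big_nil /= subrr.
      by rewrite big_cons -IH /= -!addnn !natrD; lra.
    apply: ler_sum_seq => p pS; case: (boolP (0 < _)) => hp; last by rewrite mulr0 sub0r; exact: clip_ge.
    rewrite clip1 ?mulr1; first lra.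
    have := hd p pS hp.
    have hl : `|lincomb x p - lincomb (u k) p| <= d / 2.
      apply: le_trans (lincomb_lip p (fun i => ltW (hx i))) _.
      rewrite mulrAC ler_pdivrMr // ler_pM2l ?divr_gt0 //.
      rewrite /M' (perm_big _ (perm_to_rem pS)) big_cons /= addrCA lerDl addr_ge0 //.
      by apply: sumr_ge0 => q _; apply: sumr_ge0.
    move=> hd2.
    have : d / 2 <= (-1) ^+ s * lincomb (u k) p.
      move: hl hd2; rewrite ler_norml; case: (s); rewrite ?expr0 ?expr1; lra.
    rewrite mulrCA => h3; apply: le_trans (_ : k%:R * (d / 2) <= _); last exact: ler_wpM2l.
    rewrite -ler_pdivrMr; last lra.
    by rewrite mul1r invf_div.
  move=> up; have := le_trans low up => h.
  rewrite leqNgt; apply/negP; rewrite -(ler_nat R) -natr1; lra.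
split; first by have := half false; rewrite expr0; under eq_count do rewrite mul1r.
by have := half true; rewrite expr1; under eq_count do rewrite mulN1r oppr_gt0.
Qed.
End HamSandwich.

(** * Roots and sign changes of univariate polynomials *)

Section UnivariatePoly.
Variable R : rcfType.
Implicit Types (p : {poly R}) (s : seq {poly R}).

Lemma ex_nonroot p : p != 0 -> exists t, p.[t] != 0.
Proof.
move=> p0; pose ts : seq R := [seq k%:R | k <- iota 0 (size p)].
have /allPn[t _ ht] : ~~ all (root p) ts.
  apply/negP => h; have := max_poly_roots p0 h.
  rewrite map_inj_uniq ?iota_uniq ?size_map ?size_iota ?ltnn; first by move=> /(_ isT).
  by move=> a b /eqP; rewrite eqr_nat => /eqP.
by exists t.
Qed.

Lemma ex_common_nonroot s : all (predC1 0) s -> exists t, all (fun p => p.[t] != 0) s.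
Proof.
move=> h; have /ex_nonroot[t ht] : \prod_(p <- s) p != 0.
  by rewrite prodf_seq_neq0; apply/allP => p ps /=; exact: (allP h p ps).
exists t; apply/allP => p ps; move: ht; rewrite horner_prod prodf_seq_neq0 => /allP/(_ p ps).
by [].
Qed.

Lemma all_roots p : p != 0 -> exists rs : seq R,
  (size rs < size p)%N /\ forall x, root p x -> x \in rs.
Proof.
move: {2}(size p) (leqnn (size p)) => n; elim: n p => [|n IH] p.
  by rewrite leqn0 size_poly_eq0 => /eqP ->; rewrite eqxx.
move=> sp p0.
have [[x rx]|nr] := pselect (exists x, root p x); last first.
  exists [::]; split; first by rewrite size_poly_gt0.
  by move=> x rx; case: nr; exists x.
have /factor_theorem[q e] := rx.
have q0 : q != 0 by apply: contraNneq p0 => q0; rewrite e q0 mul0r.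
have sq : size p = (size q).+1 by rewrite e size_Mmonic ?monicXsubC // size_XsubC addn2.
have [|//|rs [srs hrs]] := IH q; first by rewrite -ltnS -sq.
exists (x :: rs); split; first by rewrite sq.
by move=> y; rewrite e rootM root_XsubC inE => /orP[/hrs ->|->]; rewrite ?orbT.
Qed.
End UnivariatePoly.

(** By the intermediate value theorem no [g] changes sign between neighbouring roots of the product.
    The sign vector at [t] thus depends only on [nu t], the number of listed roots below [t], which
    takes at most one value more than there are listed roots. *)
Lemma sign_vectors (R : rcfType) (gs : seq {poly R}) (ts : seq R) :
  \prod_(g <- gs) g != 0 -> (forall t, t \in ts -> (\prod_(g <- gs) g).[t] != 0) ->
  (size (undup (map (fun t : R => [seq (0 < g.[t])%R | g : {poly R} <- gs]) ts)) <= size (\prod_(g <- gs) g)%R)%N.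
Proof.
move=> G0 hts; have [rs [srs hrs]] := all_roots G0.
pose nu (t : R) := count (fun r => r < t) rs.
pose sv (t : R) := [seq (0 < g.[t])%R | g : {poly R} <- gs].
have nu_le t : (nu t < (size rs).+1)%N by rewrite ltnS count_size.
have hroot t t' g : t < t' -> nu t = nu t' -> g \in gs -> g.[t] * g.[t'] < 0 -> False.
  move=> tt e ggs gneg.
  have [x /andP[xt xt'] rx] : exists2 x, t <= x <= t' & root g x.
    have [g1|g1] := ltP g.[t] 0.
      have g2 : 0 <= g.[t'] by rewrite -(nmulr_rle0 _ g1) ltW.
      by apply: (poly_ivt (ltW tt)) => //; rewrite (ltW g1) g2.
    have g2 : g.[t'] <= 0.
      rewrite leNgt; apply/negP => g2; have := mulr_ge0 g1 (ltW g2); lra.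
    have [|x h rx] := @poly_ivt _ (- g) _ _ (ltW tt); first by rewrite !hornerN; lra.
    by exists x => //; rewrite -rootN.
  have xrs : x \in rs.
    by apply: hrs; rewrite /root horner_prod; rewrite prodf_seq_eq0; apply/hasP; exists g.
  have xnt : x != t by apply: contraL gneg => /eqP <-; rewrite (rootP rx) mul0r ltxx.
  have xnt' : x != t' by apply: contraL gneg => /eqP <-; rewrite (rootP rx) mulr0 ltxx.
  have : (nu t < nu t')%N.
    rewrite /nu; have := perm_to_rem xrs => /permP h; rewrite !h /=.
    have -> : x < t = false by apply/negbTE; rewrite -leNgt.
    rewrite lt_neqAle xnt' xt' /= add0n add1n ltnS; apply: sub_count => r /= rt; exact: lt_trans tt.
  by rewrite e ltnn.
have key u u' g : g \in gs -> u' \in ts -> nu u = nu u' -> 0 < g.[u] -> 0 < g.[u'].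
  move=> ggs hu' e gu; rewrite ltNge le_eqVlt; apply/norP; split.
    by have := hts _ hu'; rewrite horner_prod prodf_seq_neq0 => /allP/(_ g ggs).
  apply/negP => gu'; have neg : g.[u] * g.[u'] < 0 by rewrite pmulr_rlt0.
  have [uu|uu|uu] := ltgtP u u'; first exact: (hroot u u' g uu).
    by apply: (hroot u' u g uu) => //; rewrite mulrC.
  by move: neg; rewrite uu -expr2 ltNge sqr_ge0.
have nu_sv t t' : t \in ts -> t' \in ts -> nu t = nu t' -> sv t = sv t'.
  by move=> hT hT' e; apply/eq_in_map => g ggs; apply/idP/idP; apply: key.
have sub : {subset undup (map sv ts) <= map (fun k => sv (nth 0 ts (find (fun t => nu t == k) ts))) (iota 0 (size rs).+1)}.
  move=> v; rewrite mem_undup => /mapP[t tT ->]; apply/mapP; exists (nu t).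
    by rewrite mem_iota add0n nu_le.
  have hh : has (fun t0 => nu t0 == nu t) ts by apply/hasP; exists t.
  by apply: nu_sv => //; [rewrite mem_nth // -has_find | rewrite (eqP (nth_find 0 hh))].
have := uniq_leq_size (undup_uniq _) sub; rewrite size_map size_iota => h.
exact: leq_trans h srs.
Qed.

(** * Polynomials in several variables: restriction to lines, derivatives, monomials *)

Section PolyExpr.
Variables (R : rcfType) (n : nat).
Local Notation V := 'rV[R]_n.

(* Polynomials in n variables as syntax: only their values, their restrictions
   to lines and their formal derivatives matter. *)
Inductive pexp := Cst of R | Var of 'I_n | Add of pexp & pexp | Mul of pexp & pexp.

Fixpoint eval e (x : V) : R :=
  match e with
  | Cst c => c | Var i => x 0 i
  | Add a b => eval a x + eval b x | Mul a b => eval a x * eval b x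
  end.

Fixpoint deg e : nat :=
  match e with
  | Cst _ => 0 | Var _ => 1
  | Add a b => maxn (deg a) (deg b) | Mul a b => deg a + deg b
  end%N.

Fixpoint der i e :=
  match e with
  | Cst _ => Cst 0 | Var j => Cst (j == i)%:R
  | Add a b => Add (der i a) (der i b)
  | Mul a b => Add (Mul (der i a) b) (Mul a (der i b))
  end.

Fixpoint restr e (p d : V) : {poly R} :=
  match e with
  | Cst c => c%:P | Var i => (p 0 i)%:P + d 0 i *: 'X
  | Add a b => restr a p d + restr b p d | Mul a b => restr a p d * restr b p d
  end.

Lemma restrE e p d t : (restr e p d).[t] = eval e (p + t *: d).
Proof.
elim: e => [c|i|a iha b ihb|a iha b ihb] /=; rewrite ?hornerE ?iha ?ihb //.
by rewrite !mxE mulrC.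
Qed.

Lemma size_restr e p d : (size (restr e p d) <= (deg e).+1)%N.
Proof.
elim: e => [c|i|a iha b ihb|a iha b ihb] /=.
- by rewrite size_polyC; case: eqP.
- apply: leq_trans (size_polyD _ _) _; rewrite geq_max size_polyC.
  apply/andP; split; first by case: eqP.
  by apply: leq_trans (size_scale_leq _ _) _; rewrite size_polyX.
- apply: leq_trans (size_polyD _ _) _; rewrite geq_max; apply/andP; split.
    by apply: leq_trans iha _; rewrite ltnS leq_maxl.
  by apply: leq_trans ihb _; rewrite ltnS leq_maxr.
- by apply: leq_trans (size_polyMleq _ _) _; move: iha ihb; lia.
Qed.

Lemma deg_der i e : (deg (der i e) <= deg e)%N.
Proof. by elim: e => //= a iha b ihb; move: iha ihb; lia. Qed.

Lemma restr_der e p d : (restr e p d)^`() = \sum_i d 0 i *: restr (der i e) p d.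
Proof.
elim: e => [c|i|a iha b ihb|a iha b ihb] /=.
- by rewrite derivC big1 // => i _; rewrite scaler0.
- rewrite derivD derivC add0r derivZ derivX (bigD1 i) //= eqxx big1 ?addr0 //.
  by move=> j; rewrite eq_sym => /negbTE ->; rewrite scaler0.
- by rewrite derivD iha ihb -big_split; apply: eq_bigr => i _; rewrite scalerDr.
- rewrite derivM iha ihb mulr_suml mulr_sumr -big_split; apply: eq_bigr => i _ /=.
  by rewrite scalerDr -scalerAl -scalerAr.
Qed.

Lemma der_comm i j e x : eval (der i (der j e)) x = eval (der j (der i e)) x.
Proof.
elim: e => [c|k|a iha b ihb|a iha b ihb] //=; first by rewrite iha ihb.
by rewrite iha ihb; ring.
Qed.

Definition dirder (v : V) e : pexp := \big[Add/Cst 0]_i Mul (Cst (v 0 i)) (der i e).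

Lemma eval_dirder v e x : eval (dirder v e) x = \sum_i v 0 i * eval (der i e) x.
Proof. by rewrite /dirder; elim/big_rec2: _ => //= i y1 y2 _ ->. Qed.

Lemma restr_dirder v e p d : restr (dirder v e) p d = \sum_i v 0 i *: restr (der i e) p d.
Proof. by rewrite /dirder; elim/big_rec2: _ => //= i y1 y2 _ ->; rewrite mul_polyC. Qed.

Lemma deg_dirder v e : (deg (dirder v e) <= deg e)%N.
Proof.
rewrite /dirder; elim/big_rec: _ => //= i x _ h.
by rewrite geq_max h andbT add0n deg_der.
Qed.

Lemma deg_iter_dirder v k e : (deg (iter k (dirder v) e) <= deg e)%N.
Proof. by elim: k => //= k IH; apply: leq_trans (deg_dirder _ _) IH. Qed.

Lemma restr_iter_dirder v k e p : restr (iter k (dirder v) e) p v = (restr e p v)^`(k).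
Proof.
by elim: k => [|k IH] /=; rewrite ?derivn0 // restr_dirder -restr_der IH.
Qed.

(** The restriction of [e] to the line through [p] in direction [v] is nonzero at parameter 1, so
    some coefficient is nonzero; up to a factorial, it is the derivative of that order at [p]. *)
Lemma dirder_neq0 v e p : eval e (p + v) != 0 ->
  exists2 k, (k <= deg e)%N & eval (iter k (dirder v) e) p != 0.
Proof.
move=> h; have r0 : restr e p v != 0.
  by apply: contraNneq h => r0; have := restrE e p v 1; rewrite r0 horner0 scale1r => <-.
have [k hk] : exists k, (restr e p v)`_k != 0.
  by exists (size (restr e p v)).-1; rewrite -/(lead_coef _) lead_coef_eq0.
exists k.
  rewrite leqNgt; apply/negP => kd; move: hk; rewrite nth_default ?eqxx //.
  exact: leq_trans (size_restr _ _ _) _.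
have := restrE (iter k (dirder v) e) p v 0; rewrite scale0r addr0 => <-.
rewrite restr_iter_dirder horner_coef0 coef_derivn addn0 ffactnn.
by rewrite mulrn_eq0 negb_or hk andbT -lt0n fact_gt0.
Qed.

(** Points are added one by one. Moving [v] to [v + t *: (q - p - v)] leaves the earlier points good
    at t = 0 and takes [p + v] to [q] at t = 1, so all the restrictions are nonzero polynomials in t
    and have a common nonroot. *)
Lemma ex_direction e q (P : seq V) : eval e q != 0 ->
  exists v, forall p, p \in P -> eval e (p + v) != 0.
Proof.
move=> hq; elim: P => [|p P [v hv]]; first by exists 0.
have [|t] := @ex_common_nonroot R [seq restr e (p' + v) (q - p - v) | p' <- p :: P].
  apply/allP => _ /mapP[p' pP ->] /=; apply/negP => /eqP r0.
  move: pP; rewrite inE => /orP[/eqP pp|/hv]; last first.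
    by have := restrE e (p' + v) (q - p - v) 0; rewrite r0 horner0 scale0r addr0 => <-; rewrite eqxx.
  have := restrE e (p' + v) (q - p - v) 1; rewrite r0 horner0 scale1r pp.
  by rewrite addrACA subrr addr0 addrC subrK => e0; move: hq; rewrite -e0 eqxx.
rewrite all_map => /allP h; exists (v + t *: (q - p - v)) => p' pP.
by have := h p' pP; rewrite /= restrE addrA.
Qed.

Fixpoint prodexp (fs : seq pexp) := if fs is f :: fs' then Mul f (prodexp fs') else Cst 1.

Lemma restr_prodexp fs p d : restr (prodexp fs) p d = \prod_(f <- fs) restr f p d.
Proof. by elim: fs => [|f fs IH]; rewrite ?big_nil //= big_cons IH. Qed.

Lemma Mul_neq0 a b q q' : eval a q != 0 -> eval b q' != 0 -> exists z, eval (Mul a b) z != 0.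
Proof.
move=> ha hb; have [|t] := @ex_common_nonroot R [:: restr a q (q' - q); restr b q (q' - q)].
  rewrite /= andbT; apply/andP; split; apply/negP => /eqP r0.
    by have := restrE a q (q' - q) 0; rewrite r0 horner0 scale0r addr0 => e; rewrite -e eqxx in ha.
  by have := restrE b q (q' - q) 1; rewrite r0 horner0 scale1r subrKC => e; rewrite -e eqxx in hb.
rewrite /= andbT !restrE => h; exists (q + t *: (q' - q)).
by rewrite /= mulf_eq0 negb_or.
Qed.

Definition powexp e m := iter m (Mul e) (Cst 1).

(* The k-th monomial with all exponents below b: the exponents are the base b digits of k. *)
Definition mono b k :=
  \big[Mul/Cst 1]_(i < n) powexp (Var i) (k %/ b ^ i %% b).

Lemma eval_mono b k x : eval (mono b k) x = \prod_(i < n) x 0 i ^+ (k %/ b ^ i %% b).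
Proof.
have hp e m : eval (powexp e m) x = eval e x ^+ m.
  by elim: m => [|m IH] /=; rewrite ?expr0 // exprS IH.
by rewrite /mono; elim/big_rec2: _ => //= i y1 y2 _ ->; rewrite hp.
Qed.

Lemma deg_mono b k : (0 < b)%N -> (deg (mono b k) <= n * b.-1)%N.
Proof.
move=> b0; have hp i m : deg (powexp (Var i) m) = m.
  by elim: m => //= m ->.
rewrite -[n in (n * _)%N]card_ord -sum_nat_const /mono.
elim/big_rec2: _ => //= i y1 y2 _ h; rewrite hp leq_add //.
by rewrite -ltnS prednK // ltn_pmod.
Qed.

Lemma digits b k m : (\sum_(i < m) (k %/ b ^ i %% b) * b ^ i)%N = (k %% b ^ m)%N.
Proof.
elim: m => [|m IH]; first by rewrite big_ord0 expn0 modn1.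
rewrite big_ord_recr /= IH expnS addnC; case: b {IH} => [|b].
  case: m => [|m]; first by rewrite expn0 modn1 muln1 mul0n divn1 addn0.
  by rewrite exp0n // divn0 mod0n.
have b0 : (0 < b.+1 ^ m)%N by rewrite expn_gt0.
have e : k = (k %/ b.+1 ^ m %/ b.+1 * (b.+1 * b.+1 ^ m) +
    (k %/ b.+1 ^ m %% b.+1 * b.+1 ^ m + k %% b.+1 ^ m))%N.
  by rewrite addnA mulnA -mulnDl -divn_eq -divn_eq.
rewrite [in RHS]e modnMDl [RHS]modn_small //.
have h1 : (k %/ b.+1 ^ m %% b.+1 < b.+1)%N by rewrite ltn_pmod.
have h2 : (k %% b.+1 ^ m < b.+1 ^ m)%N by rewrite ltn_pmod.
apply: (@leq_trans ((k %/ b.+1 ^ m %% b.+1).+1 * b.+1 ^ m)); last by rewrite leq_mul2r h1 orbT.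
by rewrite mulSn addnC ltn_add2r.
Qed.

Definition polyexp b N (x : 'rV[R]_N) := \big[Add/Cst 0]_(k < N) Mul (Cst (x 0 k)) (mono b k).

Lemma eval_polyexp b N (x : 'rV[R]_N) p :
  eval (polyexp b x) p = \sum_(k < N) x 0 k * eval (mono b k) p.
Proof. by rewrite /polyexp; elim/big_rec2: _ => //= i y1 y2 _ ->. Qed.

Lemma deg_polyexp b N (x : 'rV[R]_N) : (0 < b)%N -> (deg (polyexp b x) <= n * b.-1)%N.
Proof.
move=> b0; rewrite /polyexp; elim/big_rec: _ => //= i y _ h.
by rewrite geq_max h andbT add0n deg_mono.
Qed.

(* Kronecker substitution x_i = t^(b^i) turns the k-th monomial into t^k. *)
Lemma polyexp_neq0 b N (x : 'rV[R]_N) : (N <= b ^ n)%N -> x != 0 ->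
  exists q, eval (polyexp b x) q != 0.
Proof.
move=> Nb x0; have /ex_nonroot[t ht] : \poly_(k < N) (if insub k is Some i then x 0 i else 0) != 0.
  apply: contraNneq x0 => h; apply/eqP/rowP => i; rewrite mxE.
  have := congr1 (fun p : {poly R} => p`_i) h; rewrite coef_poly ltn_ord coef0 => <-.
  by rewrite valK.
exists (\row_i t ^+ (b ^ i)); move: ht; rewrite horner_poly eval_polyexp.
congr (_ != 0); apply: eq_bigr => k _; rewrite valK; congr (_ * _).
rewrite eval_mono (eq_bigr (fun i : 'I_n => t ^+ ((k %/ b ^ i %% b) * b ^ i))).
  by rewrite prodrXr digits modn_small // (leq_trans (ltn_ord k)).
by move=> i _; rewrite mxE -exprM mulnC.
Qed.

End PolyExpr.

(** * Partition by repeated simultaneous halving *)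

Section Partition.
Variables (R : realType) (n : nat).
Local Notation V := 'rV[R]_n.

Definition sign_vector (fs : seq (pexp R n)) (p : V) := [seq (0 < eval f p)%R | f <- fs].

Definition in_cell fs s p := (eval (prodexp fs) p != 0) && (sign_vector fs p == s).

(** Halving the 2^j current cells at once takes 2^j + 1 monomials, and [b ^ n] of them have
    exponents below [b]. The nonzero coefficient vector from [ham_sandwich] gives a nonzero
    polynomial by Kronecker substitution. *)
Lemma partition_step b (P : seq V) fs :
  (2 ^ size fs < b ^ n)%N -> (exists q, eval (prodexp fs) q != 0) ->
  (forall s, 2 ^ size fs * count (in_cell fs s) P <= size P)%N ->
  exists f, [/\ (deg f <= n * b.-1)%N, exists q, eval (prodexp (f :: fs)) q != 0 &
    forall s, (2 ^ (size fs).+1 * count (in_cell (f :: fs) s) P <= size P)%N].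
Proof.
move=> hb [q hq] hP; set j := size fs in hb hP *.
pose N := #|{: j.-tuple bool}|.
have NE : N = (2 ^ j)%N by rewrite /N card_tuple card_bool.
pose S (i : 'I_N) := [seq p <- P | in_cell fs (enum_val i : j.-tuple bool) p].
have [x [x0 hx]] := ham_sandwich S (fun k p => eval (mono R n b k) p).
have b0 : (0 < b)%N.
  rewrite lt0n; apply: contraL hb => /eqP ->; rewrite -leqNgt.
  by apply: (@leq_trans 1); [case: (n) => // m; rewrite exp0n | rewrite expn_gt0].
have [//|//|q' hq'] := @polyexp_neq0 R n b N.+1 x; first by rewrite NE.
exists (polyexp n b x); split; first exact: deg_polyexp.
  exact: Mul_neq0 hq' hq.
move=> s; have [/eqP ss|ss] := boolP (size s == j.+1); last first.
  rewrite (eq_count (a2 := pred0)) ?count_pred0 ?muln0 // => p.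
  rewrite /in_cell; apply/negbTE; apply: contra ss => /andP[_ /eqP <-].
  by rewrite size_map.
case: s ss => [//|s0 s] [ss].
pose i : 'I_N := enum_rank (Tuple (introT eqP ss)).
have iE : enum_val i = s :> seq bool by rewrite enum_rankK.
have hle : (count (in_cell (polyexp n b x :: fs) (s0 :: s)) P <=
    count (fun p => if s0 then 0 < eval (polyexp n b x) p else eval (polyexp n b x) p < 0)%R (S i))%N.
  rewrite count_filter iE; apply: sub_count => p /=.
  rewrite /in_cell /= mulf_eq0 negb_or eqseq_cons => /andP[/andP[h1 h2] /andP[/eqP <- ->]].
  by rewrite h2 /= andbT; case: ltgtP h1.
rewrite expnS mulnAC mul2n.
have : ((count (fun p => if s0 then 0 < eval (polyexp n b x) p else eval (polyexp n b x) p < 0)%R (S i)).*2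
   <= size (S i))%N.
  have [h1 h2] := hx i; case: (s0).
    by move: h1; under eq_count do rewrite /lincomb -eval_polyexp.
  by move: h2; under eq_count do rewrite /lincomb -eval_polyexp.
move=> h2; apply: leq_trans (hP s); rewrite mulnC leq_mul2l; apply/orP; right.
have <- : size (S i) = count (in_cell fs s) P by rewrite size_filter iE.
by apply: leq_trans h2; rewrite leq_double.
Qed.

(** Halvings come in rounds of [n]. The polynomials of one round have exponents below [2 ^ K.+1],
    hence degree at most [n * 2 ^ K.+1], so the round adds at most n^2 2^(K+1), which doubles the
    degree bound. *)
Lemma polynomial_partition K (P : seq V) : exists fs,
  [/\ exists q, eval (prodexp fs) q != 0, (deg (prodexp fs) <= 2 * n ^ 2 * 2 ^ K)%N &
   forall s, (2 ^ (n * K) * count (in_cell fs s) P <= size P)%N].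
Proof.
suff : exists fs, [/\ exists q, eval (prodexp fs) q != 0,
    (deg (prodexp fs) <= 2 * n ^ 2 * 2 ^ K)%N, size fs = (n * K)%N &
    forall s, (2 ^ size fs * count (in_cell fs s) P <= size P)%N].
  by case=> fs [h1 h2 h3 h4]; exists fs; split => // s; rewrite -h3.
elim: K => [|K [fs [h1 h2 h3 h4]]].
  exists [::]; rewrite muln0 /=; split => //; first by exists 0; rewrite oner_neq0.
  by move=> s; rewrite mul1n count_size.
suff H i : (i <= n)%N -> exists fs, [/\ exists q, eval (prodexp fs) q != 0,
    (deg (prodexp fs) <= 2 * n ^ 2 * 2 ^ K + i * (n * 2 ^ K.+1))%N, size fs = (n * K + i)%N &
    forall s, (2 ^ size fs * count (in_cell fs s) P <= size P)%N].
  have [gs [g1 g2 g3 g4]] := H n (leqnn n); exists gs; split => //.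
    by apply: leq_trans g2 _; rewrite (expnS 2 K) -mulnn; lia.
  by rewrite g3 mulnS addnC.
elim: i => [|i IH] ni; first by exists fs; rewrite mul0n !addn0.
have [gs [g1 g2 g3 g4]] := IH (ltnW ni).
have [||//|f [f1 f2 f3]] := @partition_step (2 ^ K.+1) P gs.
- by rewrite g3 -expnM ltn_exp2l //; nia.
- exact: g1.
exists (f :: gs); split => //=.
  rewrite mulSn addnCA leq_add //; apply: leq_trans f1 _; exact: leq_mul (leqnn _) (leq_pred _).
by rewrite g3 addnS.
Qed.

End Partition.

(** * The Szemeredi-Trotter bound *)

Section LinesAndCells.
Variables (R : realType) (n : nat).
Local Notation V := 'rV[R]_n.
Variables (U : eqType) (base dir : U -> V) (tau : V -> R) (inc : V -> U -> bool).
Hypothesis incP : forall p l, inc p l -> p = base l + tau p *: dir l.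

Definition on_zero (F : pexp R n) l := restr F (base l) (dir l) == 0.

Lemma restr_inc F p l : inc p l -> (restr F (base l) (dir l)).[tau p] = eval F p.
Proof. by move=> i; rewrite restrE -incP. Qed.

Lemma zeros_on_line F (P : seq V) l : uniq P -> ~~ on_zero F l ->
  (count (fun p => inc p l && (eval F p == 0)%R) P <= deg F)%N.
Proof.
move=> uP nz; rewrite -size_filter -(size_map tau) -ltnS.
apply: leq_trans (size_restr F (base l) (dir l)); apply: max_poly_roots => //.
  apply/allP => x /mapP[p]; rewrite mem_filter => /andP[/andP[i /eqP h] _] ->.
  by rewrite /root restr_inc ?h.
rewrite map_inj_in_uniq ?filter_uniq // => p p'.
rewrite !mem_filter => /andP[/andP[i _] _] /andP[/andP[i' _] _] e.
by rewrite (incP i) (incP i') e.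
Qed.

(** The restrictions of the factors to the line are univariate, so [sign_vectors] applies; a single
    point off the zero set shows that their product is nonzero. *)
Lemma cells_on_line fs (P : seq V) l :
  (size (undup [seq sign_vector fs p | p <- [seq p <- P | eval (prodexp fs) p != 0%R] & inc p l])
    <= (deg (prodexp fs)).+1)%N.
Proof.
set ps := [seq p <- _ | inc p l].
have hps p : p \in ps -> inc p l /\ eval (prodexp fs) p != 0.
  by rewrite !mem_filter => /andP[-> /andP[->]].
case e : ps => [//|p0 ps']; rewrite -e.
have G0 : restr (prodexp fs) (base l) (dir l) != 0.
  have [i h] : inc p0 l /\ eval (prodexp fs) p0 != 0 by apply: hps; rewrite e mem_head.
  by apply: contraNneq h => r0; rewrite -(restr_inc _ i) r0 horner0.
apply: leq_trans (size_restr _ (base l) (dir l)).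
pose gs := [seq restr f (base l) (dir l) | f <- fs].
have GE : \prod_(g <- gs) g = restr (prodexp fs) (base l) (dir l).
  by rewrite restr_prodexp big_map.
have := @sign_vectors R gs (map tau ps); rewrite GE => /(_ G0).
rewrite -map_comp => h; apply: leq_trans (h _).
  suff -> : map (sign_vector fs) ps =
      map ((fun t : R => [seq 0 < g.[t] | g : {poly R} <- gs]) \o tau) ps by [].
  apply/eq_in_map => p /hps[i _] /=.
  rewrite /sign_vector /gs -map_comp; apply/eq_map => f /=.
  by rewrite restr_inc.
by move=> _ /mapP[p /hps[i hp] ->]; rewrite restr_inc.
Qed.

End LinesAndCells.

Section PlanarSzemerediTrotter.
Variable R : realType.
Local Notation V := 'rV[R]_2.
Local Notation line := (R * R)%type.

Definition pinc (p : V) (l : line) := p 0 1 == l.1 * p 0 0 + l.2.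
Definition pbase (l : line) : V := \row_i (if i == 0 then 0 else l.2).
Definition pdir (l : line) : V := \row_i (if i == 0 then 1 else l.1).

Lemma pincP p l : pinc p l -> p = pbase l + p 0 0 *: pdir l.
Proof.
move/eqP => e; apply/rowP => i; rewrite !mxE; have [->|i0] := eqVneq i 0; first by rewrite add0r mulr1.
have -> : i = 1 by apply/val_inj; case: i i0 => [[|[|]]].
by rewrite e addrC mulrC.
Qed.

Lemma pinc_linear : linear_inc pinc.
Proof.
move=> p p' [a b] [a' b'] pp' /eqP /= e1 /eqP /= e2 /eqP /= e3 /eqP /= e4.
have x0 : p 0 0 - p' 0 0 != 0.
  apply: contraNneq pp' => h; apply/eqP/rowP => i.
  have hx : p 0 0 = p' 0 0 by lra.
  have [->//|i0] := eqVneq i 0.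
  have -> : i = 1 by apply/val_inj; case: i i0 => [[|[|]]].
  by rewrite e1 e2 hx.
have ea : a = a'.
  have : (a - a') * (p 0 0 - p' 0 0) = 0 by rewrite mulrBl !mulrBr; lra.
  by move/eqP; rewrite mulf_eq0 (negbTE x0) orbF subr_eq0 => /eqP.
by rewrite -ea in e3 *; congr pair; lra.
Qed.

(** A vertical line x = t is chosen on which [F] is not identically zero and which meets the lines
    of [L] in distinct points; each of these is a root of [F]. *)
Lemma lines_in_curve F q (L : seq line) : eval F q != 0 -> uniq L ->
  (forall l, l \in L -> on_zero pbase pdir F l) -> (size L <= deg F)%N.
Proof.
move=> hq uL hL.
pose q2 : V := \row_i (if i == 0 then 0 else q 0 1).
pose e0 : V := \row_i (if i == 0 then 1 else 0).
pose e1 : V := \row_i (if i == 0 then 0 else 1).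
have i1 (i : 'I_2) : i != 0 -> i = 1 by move=> i0; apply/val_inj; case: i i0 => [[|[|]]].
have [|t] := @ex_common_nonroot R (restr F q2 e0 ::
    [seq (l.1 - l'.1)%:P * 'X + (l.2 - l'.2)%:P | l <- L, l' <- [seq l' <- L | l' != l]]).
  apply/allP => g; rewrite inE => /orP[/eqP ->|/allpairsPdep[l [l' [lL]]]].
    apply: contraNneq hq => h; have := restrE F q2 e0 (q 0 0); rewrite h horner0 => e.
    rewrite [X in _ == X]e; apply/eqP; congr eval; apply/rowP => i; rewrite !mxE.
    by have [->|/i1 ->] := eqVneq i 0; rewrite ?add0r ?mulr1 ?mulr0 ?addr0.
  rewrite mem_filter => /andP[ll' _] -> /=; apply: contraNneq ll' => h.
  have := congr1 (horner^~ 0) h; have := congr1 (horner^~ 1) h.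
  rewrite /= !hornerMXaddC !hornerC ?horner0 mulr1 mulr0 => h1 h0.
  have e2 : l.2 = l'.2 by lra.
  have e3 : l.1 = l'.1 by lra.
  by apply/eqP; case: (l) (l') e2 e3 => [? ?] [? ?] /= -> ->.
case/andP=> ht /allP hpair.
pose b : V := \row_i (if i == 0 then t else 0).
have G0 : restr F b e1 != 0.
  apply: contraNneq ht => h; rewrite restrE.
  have := restrE F b e1 (q 0 1); rewrite h horner0 => e.
  rewrite [X in _ == X]e; apply/eqP; congr eval; apply/rowP => i; rewrite !mxE.
  by case: (eqVneq i 0) => _; rewrite ?add0r ?mulr1 ?mulr0 ?addr0.
rewrite -ltnS -(size_map (fun l : line => l.1 * t + l.2)).
apply: leq_trans (size_restr F b e1); apply: max_poly_roots => //.
  apply/allP => _ /mapP[l lL ->]; have /eqP hl := hL l lL.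
  have := restrE F (pbase l) (pdir l) t; rewrite hl horner0 /root restrE => e.
  rewrite [X in _ == X]e; apply/eqP; congr eval; apply/rowP => i; rewrite !mxE.
  by case: (eqVneq i 0) => _; rewrite ?add0r ?mulr1 ?mulr0 ?addr0 // addrC mulrC.
rewrite map_inj_in_uniq // => l l' lL l'L e; apply/eqP; apply: contraT => ll'.
have /hpair : (l.1 - l'.1)%:P * 'X + (l.2 - l'.2)%:P \in
    [seq (l.1 - l'.1)%:P * 'X + (l.2 - l'.2)%:P | l <- L, l' <- [seq l' <- L | l' != l]].
  by apply/allpairsPdep; exists l, l'; rewrite mem_filter eq_sym ll'.
by rewrite hornerMXaddC hornerC => /eqP[]; lra.
Qed.

(** In each cell the trivial bound costs one per line met and the square of at most size P / 4^K
    points. On the zero set, a line not inside it carries at most [deg F] points, and at most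
    [deg F] lines lie inside. The factor [4 ^ K] keeps the estimate in the natural numbers. *)
Lemma planar_st_param K (P : seq V) (L : seq line) : uniq P -> uniq L ->
  (4 ^ K * inc_count pinc P L <= 
   4 ^ K * (17 * 2 ^ K * size L + size P + 64 * 4 ^ K) + size P ^ 2)%N.
Proof.
move=> uP uL; have [fs [[q hq] hdeg hcell]] := polynomial_partition K P.
set F := prodexp fs in hq hdeg hcell.
have hD : (deg F <= 8 * 2 ^ K)%N by [].
pose P1 := [seq p <- P | eval F p != 0]; pose L0 := [seq l <- L | on_zero pbase pdir F l].
pose inc1 p l := (eval F p != 0) && pinc p l.
pose inc2 p l := pinc p l && (eval F p == 0) && ~~ on_zero pbase pdir F l.
pose inc3 p l := pinc p l && on_zero pbase pdir F l.
have split3 : (inc_count pinc P L <= inc_count inc1 P L + (inc_count inc2 P L + inc_count inc3 P L))%N.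
  apply: leq_trans (_ : inc_count inc1 P L + inc_count (fun p l => inc2 p l || inc3 p l) P L <= _)%N.
    apply: inc_count_or => p l _ _ i; rewrite /inc1 /inc2 /inc3 i /=.
    by case: eqP => //=; case: (on_zero _ _ _ _).
  by rewrite leq_add2l; apply: inc_count_or.
have b2 : (inc_count inc2 P L <= deg F * size L)%N.
  apply: inc_count_lines => l _; have [nz|nz] := boolP (on_zero pbase pdir F l).
    by rewrite (eq_count (a2 := pred0)) ?count_pred0 // => p; rewrite /inc2 nz andbF.
  rewrite (eq_count (a2 := fun p => pinc p l && (eval F p == 0))); last by move=> p; rewrite /inc2 nz andbT.
  exact: zeros_on_line pincP _ _ _ uP nz.
have b3 : (inc_count inc3 P L <= size P + deg F ^ 2)%N.
  have -> : inc_count inc3 P L = inc_count pinc P L0.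
    apply: eq_bigr => p _; rewrite [RHS]big_filter [RHS]big_mkcond; apply: eq_bigr => l _.
    by rewrite /inc3; case: (on_zero _ _ _ _); rewrite ?andbT ?andbF.
  apply: leq_trans (inc_count_trivial_dual pinc_linear uP (filter_uniq _ uL)) _.
  rewrite leq_add2l leq_sqr; apply: lines_in_curve hq (filter_uniq _ uL) _ => l.
  by rewrite mem_filter => /andP[].
have b1 : (4 ^ K * inc_count inc1 P L <= 4 ^ K * ((deg F).+1 * size L) + size P ^ 2)%N.
  have -> : inc_count inc1 P L = inc_count pinc P1 L.
    rewrite /inc_count [RHS]big_filter [RHS]big_mkcond; apply: eq_bigr => p _.
    rewrite /inc1; case: (eval F p != 0) => //.
    by rewrite big1.
  rewrite (inc_count_classes (sign_vector fs)).
  apply: leq_trans (_ : 4 ^ K * \sum_(c <- keys (sign_vector fs) P1)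
     (size (class_lines (sign_vector fs) pinc P1 L c) + size (class_pts (sign_vector fs) P1 c) ^ 2) <= _)%N.
    rewrite leq_mul2l; apply/orP; right; apply: leq_sum => c _.
    by apply: inc_count_trivial pinc_linear _ _; rewrite !filter_uniq.
  rewrite big_split mulnDr leq_add //.
    rewrite leq_mul2l; apply/orP; right; apply: sum_class_lines => l lL.
    exact: cells_on_line pincP fs P l.
  rewrite big_distrr /= -mulnn.
  apply: leq_trans (_ : size P1 * size P <= _)%N; last by rewrite leq_mul2r size_filter count_size orbT.
  rewrite -(sum_class_pts (sign_vector fs) P1) big_distrl /=; apply: leq_sum => c _.
  rewrite -mulnn mulnCA leq_mul2l; apply/orP; right.
  apply: leq_trans (hcell c); rewrite [(2 ^ (2 * K))%N]expnM leq_mul2l.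
  by rewrite /class_pts /P1 -filter_predI size_filter; apply/orP; right; apply: sub_count => p /=; rewrite /in_cell andbC.
have hD2 : (deg F ^ 2 <= 64 * 4 ^ K)%N.
  apply: leq_trans (_ : (8 * 2 ^ K) ^ 2 <= _)%N; first by rewrite leq_sqr.
  by rewrite expnMn -[((2 ^ K) ^ 2)%N]expnM mulnC [(K * 2)%N]mulnC expnM mulnC.
have K0 : (0 < 2 ^ K)%N by rewrite expn_gt0.
have : (inc_count pinc P L <= inc_count inc1 P L + ((deg F) * size L + (size P + 64 * 4 ^ K)))%N.
  by move: split3 b2 b3 hD2; lia.
have b1' : ((deg F).+1 * size L + deg F * size L <= 17 * 2 ^ K * size L)%N.
  by rewrite -mulnDl leq_mul2r; apply/orP; right; lia.
move: b1 b1'; set X := inc_count _ _ _; set Y := inc_count _ _ _; set u := ((deg F).+1 * size L)%N.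
set v := (deg F * size L)%N; set w := (17 * _ * _)%N; move: (4 ^ K)%N (64 * 4 ^ K)%N => E z; nia.
Qed.

End PlanarSzemerediTrotter.

(** * Cube roots, Hoelder's inequality and the optimised planar bound *)

Section CubeRoots.
Variable R : realType.
Implicit Types x y : R.

Definition cbrt x := x `^ (3^-1).

Lemma cbrt_ge0 x : 0 <= cbrt x. Proof. exact: powR_ge0. Qed.

Lemma cbrtK x : 0 <= x -> cbrt x ^+ 3 = x.
Proof. by move=> x0; rewrite /cbrt -powR_mulrn ?powR_ge0 // -powRrM mulVf // powRr1. Qed.

Lemma cbrt_le x y : 0 <= x -> 0 <= y -> y <= x ^+ 3 -> cbrt y <= x.
Proof.
move=> x0 y0 h; rewrite -(ler_pXn2r (n := 3)) ?nnegrE ?cbrt_ge0 //.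
by rewrite cbrtK.
Qed.

Lemma dyadic x : 1 <= x -> exists K, (2 ^ K)%:R <= x < 2 * (2 ^ K)%:R.
Proof.
move=> x1; have x0 : 0 <= x by lra.
have /andP[t1 t2] := truncn_itv x0.
have t0 : (0 < Num.truncn x)%N by rewrite truncn_gt0.
have /andP[h1 h2] := trunc_log_bounds (ltnSn 1) t0.
exists (trunc_log 2 (Num.truncn x)); apply/andP; split.
  by apply: le_trans t1; rewrite ler_nat.
apply: lt_le_trans t2 _; rewrite -natrM ler_nat -expnS.
exact: h2.
Qed.

Lemma amgm21 x y : 0 <= x -> 0 <= y -> 3 * (x * y ^+ 2) <= x ^+ 3 + 2 * y ^+ 3.
Proof.
move=> x0 y0; rewrite -subr_ge0.
have -> : x ^+ 3 + 2 * y ^+ 3 - 3 * (x * y ^+ 2) = (x - y) ^+ 2 * (x + 2 * y) by ring.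
by rewrite mulr_ge0 ?sqr_ge0 //; lra.
Qed.

Lemma hoelder21 (I : Type) (s : seq I) (f g : I -> R) (a b : R) :
  (forall i, 0 <= f i) -> (forall i, 0 <= g i) -> 0 < a -> 0 < b ->
  \sum_(i <- s) f i ^+ 3 <= a ^+ 3 -> \sum_(i <- s) g i ^+ 3 <= b ^+ 3 ->
  \sum_(i <- s) f i * g i ^+ 2 <= a * b ^+ 2.
Proof.
move=> f0 g0 a0 b0 hf hg.
  have : \sum_(i <- s) 3 * ((f i / a) * (g i / b) ^+ 2) <= 3.
    apply: le_trans (_ : \sum_(i <- s) ((f i / a) ^+ 3 + 2 * (g i / b) ^+ 3) <= _).
      by apply: ler_sum => i _; apply: amgm21; rewrite divr_ge0 // ltW.
    rewrite big_split /= -mulr_sumr.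
    have e (c : R) (h : I -> R) : \sum_(i <- s) (h i / c) ^+ 3 = (\sum_(i <- s) h i ^+ 3) / c ^+ 3.
      by rewrite mulr_suml; apply: eq_bigr => i _; rewrite expr_div_n.
    rewrite !e.
    have : (\sum_(i <- s) f i ^+ 3) / a ^+ 3 <= 1 by rewrite ler_pdivrMr ?exprn_gt0 // mul1r.
    have : (\sum_(i <- s) g i ^+ 3) / b ^+ 3 <= 1 by rewrite ler_pdivrMr ?exprn_gt0 // mul1r.
    lra.
  have -> : \sum_(i <- s) 3 * (f i / a * (g i / b) ^+ 2) = (3 * \sum_(i <- s) f i * g i ^+ 2) / (a * b ^+ 2).
    rewrite mulr_sumr mulr_suml; apply: eq_bigr => i _; field.
    by rewrite !gt_eqF.
  rewrite ler_pdivrMr ?mulr_gt0 ?exprn_gt0 // => h; lra.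
Qed.

Definition stbound (m n : nat) : R :=
  85 * (cbrt m%:R ^+ 2 * cbrt n%:R ^+ 2 + m%:R + n%:R).

(** For m^2 <= n or n^2 <= m a trivial bound suffices. In between, [2 ^ K] is taken of order m^(2/3)
    / n^(1/3), where the terms 2^K n and m^2 / 4^K of the parametric bound are both of order m^(2/3)
    n^(2/3). *)
Lemma planar_st (P : seq 'rV[R]_2) (L : seq (R * R)) : uniq P -> uniq L ->
  (inc_count (@pinc R) P L)%:R <= stbound (size P) (size L).
Proof.
move=> uP uL; set m := size P; set n := size L; rewrite /stbound.
set u := cbrt m%:R; set v := cbrt n%:R.
have u0 : 0 <= u by apply: cbrt_ge0.
have v0 : 0 <= v by apply: cbrt_ge0.
have u3 : u ^+ 3 = m%:R by apply: cbrtK.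
have v3 : v ^+ 3 = n%:R by apply: cbrtK.
have uv : 0 <= u ^+ 2 * v ^+ 2 by rewrite mulr_ge0 ?sqr_ge0.
have m0 : 0 <= m%:R :> R by []. have n0 : 0 <= n%:R :> R by [].
have [mn|mn] := leqP (m ^ 2) n.
  have : (inc_count (@pinc R) P L)%:R <= n%:R + (m ^ 2)%:R :> R.
    by rewrite -natrD ler_nat; apply: inc_count_trivial (@pinc_linear R) uP uL.
  have : (m ^ 2)%:R <= n%:R :> R by rewrite ler_nat.
  lra.
have [nm|nm] := leqP (n ^ 2) m.
  have : (inc_count (@pinc R) P L)%:R <= m%:R + (n ^ 2)%:R :> R.
    by rewrite -natrD ler_nat; apply: inc_count_trivial_dual (@pinc_linear R) uP uL.
  have : (n ^ 2)%:R <= m%:R :> R by rewrite ler_nat.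
  lra.
have n1 : (0 < n)%N by case: (n) mn nm => // _; case: (m).
have m1 : (0 < m)%N by case: (m) mn.
have vp : 0 < v by rewrite lt_neqAle v0 eq_sym andbT; apply: contraTneq n1 => e; move: v3; rewrite e expr0n /= => /esym/eqP; rewrite pnatr_eq0 => /eqP ->.
have up : 0 < u by rewrite lt_neqAle u0 eq_sym andbT; apply: contraTneq m1 => e; move: u3; rewrite e expr0n /= => /esym/eqP; rewrite pnatr_eq0 => /eqP ->.
have h1 : v <= u ^+ 2.
  rewrite -(ler_pXn2r (n := 3)) ?nnegrE ?sqr_ge0 // v3 -exprM mulnC exprM u3 -natrX ler_nat ltnW //.
have h2 : u <= v ^+ 2.
  rewrite -(ler_pXn2r (n := 3)) ?nnegrE ?sqr_ge0 // u3 -exprM mulnC exprM v3 -natrX ler_nat ltnW //.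
have [|K /andP[k1 k2]] := @dyadic (u ^+ 2 / v); first by rewrite ler_pdivlMr // mul1r.
have cast (a b X Y Z x y : nat) : (X * Y <= X * (a * Z * y + x + b * X) + x ^ 2)%N ->
    X%:R * Y%:R <= X%:R * (a%:R * Z%:R * y%:R + x%:R + b%:R * X%:R) + x%:R ^+ 2 :> R.
  by rewrite -!(natrM, natrD, natrX) ler_nat.
have e4 : (4 ^ K)%:R = (2 ^ K)%:R ^+ 2 :> R by rewrite -natrX -expnM mulnC expnM.
have := cast _ _ _ _ _ _ _ (planar_st_param K uP uL); rewrite -/m -/n e4 -u3 -v3.
set E : R := (2 ^ K)%:R in k1 k2 *; set I : R := (inc_count _ _ _)%:R => hI.
have E0 : 0 < E by rewrite ltr0n expn_gt0.
have k3 : E * v <= u ^+ 2 by rewrite -ler_pdivlMr.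
have k4 : u ^+ 2 < 2 * (E * v) by rewrite mulrA -ltr_pdivrMr.
have a1 : E * v ^+ 3 <= u ^+ 2 * v ^+ 2.
  by rewrite (exprS v 2) mulrA ler_wpM2r // sqr_ge0.
have a2 : E <= u * v.
  rewrite -(ler_pM2r vp); apply: le_trans k3 _; rewrite expr2 -mulrA -expr2.
  exact: ler_wpM2l.
have a3 : E ^+ 2 <= u ^+ 2 * v ^+ 2.
  by rewrite -exprMn ler_pXn2r ?nnegrE ?mulr_ge0 // ltW.
have a4 : u ^+ 4 <= 4 * (E ^+ 2 * v ^+ 2).
  have : (u ^+ 2) ^+ 2 <= (2 * (E * v)) ^+ 2 by rewrite ler_pXn2r ?nnegrE ?sqr_ge0 ?mulr_ge0 // ltW.
  by rewrite -exprM !exprMn -natrX.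
have a5 : (u ^+ 3) ^+ 2 <= 4 * (u ^+ 2 * v ^+ 2) * E ^+ 2.
  have -> : (u ^+ 3) ^+ 2 = u ^+ 2 * u ^+ 4 by ring.
  have -> : 4 * (u ^+ 2 * v ^+ 2) * E ^+ 2 = u ^+ 2 * (4 * (E ^+ 2 * v ^+ 2)) by ring.
  by rewrite ler_wpM2l ?sqr_ge0.
have u30 : 0 <= u ^+ 3 by rewrite exprn_ge0.
have v30 : 0 <= v ^+ 3 by rewrite exprn_ge0.
have E20 : 0 < E ^+ 2 by rewrite exprn_gt0.
rewrite -(ler_pM2l E20); apply: le_trans hI _.
apply: le_trans (_ : E ^+ 2 * (85 * (u ^+ 2 * v ^+ 2) + u ^+ 3) <= _); last first.
  by rewrite ler_pM2l //; lra.
have -> : E ^+ 2 * (85 * (u ^+ 2 * v ^+ 2) + u ^+ 3) =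
   E ^+ 2 * (81 * (u ^+ 2 * v ^+ 2) + u ^+ 3) + 4 * (u ^+ 2 * v ^+ 2) * E ^+ 2 by ring.
apply: lerD a5; rewrite ler_pM2l //.
have -> : 17 * E * v ^+ 3 = 17 * (E * v ^+ 3) by ring.
lra.
Qed.
End CubeRoots.

(** * Lines in space and their generic projection to the plane *)

Section SpaceLines.
Variable R : realType.
Local Notation V := 'rV[R]_3.
Local Notation line := (V * V)%type.
Implicit Types (a b p q u v x y : V) (l : line).

Lemma dot3D a x y : dot3 a (x + y) = dot3 a x + dot3 a y.
Proof. by rewrite /dot3 -big_split; apply: eq_bigr => i _; rewrite mxE mulrDr. Qed.
Lemma dot3Z a c x : dot3 a (c *: x) = c * dot3 a x.
Proof. by rewrite /dot3 mulr_sumr; apply: eq_bigr => i _; rewrite mxE mulrCA. Qed.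
Lemma dot3B a x y : dot3 a (x - y) = dot3 a x - dot3 a y.
Proof. by rewrite dot3D -scaleN1r dot3Z mulN1r. Qed.

(** On the moment curve (1, t, t^2) each scalar product is a nonzero polynomial in t. *)
Lemma generic_vector (vs : seq V) : exists a, forall v, v \in vs -> v != 0 -> dot3 a v != 0.
Proof.
pose g v : {poly R} := \poly_(i < 3) v 0 (inord i).
have [|t /allP ht] := @ex_common_nonroot R [seq g v | v <- vs & v != 0].
  apply/allP => x /mapP[v]; rewrite mem_filter => /andP[v0 _] -> /=.
  apply: contraNneq v0 => h; apply/eqP/rowP => i; rewrite mxE.
  have := congr1 (fun p : {poly R} => p`_i) h.
  by rewrite coef_poly ltn_ord coef0 inord_val.
exists (\row_i t ^+ i) => v vs0 v0.
have : g v \in [seq g v | v <- vs & v != 0] by rewrite map_f // mem_filter v0.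
move=> /ht; rewrite horner_poly; congr (_ != 0); apply: eq_bigr => i _.
by rewrite mxE inord_val mulrC.
Qed.

(* A line is given by its point l.1 on the plane dot3 a x = 0 and its direction l.2
   normalised by dot3 a l.2 = 1, so that distinct lines have distinct codes. *)
Definition valid_line a l := (dot3 a l.1 == 0) && (dot3 a l.2 == 1).
Definition on_line a p l := p == l.1 + dot3 a p *: l.2.

Lemma on_lineP a p l : on_line a p l -> p = l.1 + dot3 a p *: l.2.
Proof. exact: eqP. Qed.

Lemma on_line_linear a : linear_inc (on_line a).
Proof.
move=> p p' [q u] [q' u'] pp' /eqP /= e1 /eqP /= e2 /eqP /= e3 /eqP /= e4.
have t0 : dot3 a p - dot3 a p' != 0.
  apply: contraNneq pp' => h; have t : dot3 a p = dot3 a p' by lra.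
  by apply/eqP; rewrite e1 e2 t.
move: t0 e1 e2 e3 e4; set t := dot3 a p; set t' := dot3 a p' => t0 e1 e2 e3 e4.
have eu : u = u'.
  have h : (t - t') *: u = (t - t') *: u'.
    transitivity (p - p'); first by rewrite e1 e2 scalerBl opprD addrACA subrr add0r.
    by rewrite e3 e4 scalerBl opprD addrACA subrr add0r.
  exact: (scalerI t0 h).
congr pair => //; rewrite -eu in e3.
by apply: (addIr (t *: u)); rewrite -e1 -e3.
Qed.

(** The functionals [c] and [b] project to the plane and keep incidences. A generic [c] separates
    the points and makes no image line vertical; a generic [b] then separates the lines. *)
Lemma space_st a (P : seq V) (L : seq line) : uniq P -> uniq L -> all (valid_line a) L ->
  (inc_count (on_line a) P L)%:R <= stbound R (size P) (size L).
Proof.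
move=> uP uL /allP vL.
have [c hc] := generic_vector ([seq p - p' | p <- P, p' <- P] ++ map snd L).
have cu l : l \in L -> dot3 c l.2 != 0.
  move=> lL; apply: hc; first by rewrite mem_cat orbC map_f.
  case/andP: (vL l lL) => _ /eqP h; apply: contraTneq (oner_neq0 R) => e.
  by rewrite -h e -(scale0r 0) dot3Z mul0r eqxx.
pose rho l := (dot3 c l.2)^-1 *: l.2; have rhoE l : rho l = (dot3 c l.2)^-1 *: l.2 by [].
clearbody rho.
(* The difference of the directions normalised by [c] or, if these agree, of the points where
   [dot3 c] vanishes: it is nonzero for distinct lines of [L]. *)
pose w l l' := if rho l != rho l' then rho l - rho l' else
   (l.1 - dot3 c l.1 *: rho l) - (l'.1 - dot3 c l'.1 *: rho l').
have [b hb] := generic_vector [seq w l l' | l <- L, l' <- L].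
pose pr p : 'rV[R]_2 := \row_i (if i == 0 then dot3 c p else dot3 b p).
pose pl l := (dot3 b (rho l), dot3 b l.1 - dot3 c l.1 * dot3 b (rho l)).
have ipr : {in P &, injective pr}.
  move=> p p' pP p'P e; apply/eqP; apply: contraT => pp'.
  have : dot3 c (p - p') != 0.
    by apply: hc; [rewrite mem_cat (allpairs_f (fun p p' : V => p - p') pP p'P) | rewrite subr_eq0].
  have := congr1 (fun x : 'rV[R]_2 => x 0 0) e; rewrite !mxE /= dot3B => ->.
  by rewrite subrr eqxx.
have ipl : {in L &, injective pl}.
  move=> l l' lL l'L [e1 e2].
  have hw : w l l' = 0.
    apply/eqP; apply: contraT => /(hb _ (allpairs_f w lL l'L)).
    rewrite /w; have [er|_] := eqVneq (rho l) (rho l'); rewrite /= !dot3B ?dot3Z.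
      by rewrite [X in X != 0](_ : _ = 0) ?eqxx //; lra.
    by rewrite e1 subrr eqxx.
  move: hw; rewrite /w; have [er|nr] := eqVneq (rho l) (rho l'); last first.
    by move=> /= /eqP; rewrite subr_eq0 (negbTE nr).
  rewrite /= => /eqP; rewrite subr_eq0 => /eqP h.
  have [/eqP a1 /eqP a2] := andP (vL l lL); have [/eqP a1' /eqP a2'] := andP (vL l' l'L).
  have eu : dot3 c l.2 = dot3 c l'.2.
    have := congr1 (dot3 a) er; rewrite !rhoE !dot3Z a2 a2' !mulr1; exact: invr_inj.
  have e22 : l.2 = l'.2.
    move: er; rewrite !rhoE eu => /scalerI; apply; by rewrite invr_eq0 cu.
  have e11 : l.1 = l'.1.
    have := congr1 (dot3 a) h; rewrite !dot3B !dot3Z a1 a1' er !sub0r rhoE dot3Z a2' mulr1 => /oppr_inj h2.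
    have h3 : dot3 c l.1 = dot3 c l'.1.
      by apply: (mulIf _ h2); rewrite invr_eq0 cu.
    by move: h; rewrite er h3 => /addIr.
  by case: (l) (l') e11 e22 => [? ?] [? ?] /= -> ->.
have uP' : uniq (map pr P) by rewrite map_inj_in_uniq.
have uL' : uniq (map pl L) by rewrite map_inj_in_uniq.
have := planar_st uP' uL'; rewrite !size_map; apply: le_trans.
rewrite ler_nat {2}/inc_count big_map.
under [leqRHS]eq_bigr do rewrite big_map.
apply: (@inc_count_sub _ _ _ (fun p l => pinc (pr p) (pl l))) => p l _ lL /on_lineP i.
apply/eqP; rewrite !mxE /= {1}i [in dot3 c p]i !dot3D !rhoE !dot3Z.
by field; apply: cu.
Qed.

End SpaceLines.

(** * Lines on an algebraic surface *)

(** With c the value of g / h at t, the remainder [r] satisfies the same identity and vanishes at t.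
    If it were nonzero with a root of order m + 1 there, dividing by the m-th power of ['X - t%:P]
    and evaluating at t would give (m + 1) h(t) q(t) = 0, with q the cofactor, nonzero at t. Zeros
    of h elsewhere do no harm. *)
Lemma wronskian_const (R : rcfType) (g h : {poly R}) t t' :
  h * g^`() = g * h^`() -> h.[t] != 0 -> h.[t'] != 0 -> g.[t] / h.[t] = g.[t'] / h.[t'].
Proof.
move=> e ht ht'; pose c := g.[t] / h.[t]; pose r := g - c *: h.
have er : h * r^`() = r * h^`().
  by rewrite /r derivB derivZ mulrBr mulrBl e -scalerAl -scalerAr.
have rt : r.[t] = 0 by rewrite /r !hornerE divfK // subrr.
suff r0 : r = 0.
  have := congr1 (horner^~ t') r0; rewrite /r !hornerE /= => /eqP; rewrite subr_eq0 => /eqP ->.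
  by rewrite -/c mulfK.
apply/eqP; apply: contraT => r0.
have [m [q hq rE]] := multiplicity_XsubC r t; rewrite r0 /= in hq.
case: m rE => [|m] rE; first by move: hq; rewrite /root -[q]mulr1 -(expr0 ('X - t%:P)) -rE rt eqxx.
move: er; rewrite rE derivM deriv_exp derivXsubC mul1r exprS /= => er.
have {}er : h * (q^`() * ('X - t%:P) + q *+ m.+1) = q * ('X - t%:P) * h^`().
  apply: (@mulIf _ (('X - t%:P) ^+ m)); first by rewrite expf_neq0 // polyXsubC_eq0.
  have aux (h' q' y z x w : {poly R}) : h' * (q' * y + w * x) * z = h' * (q' * (y * z) + w * (z * x)).
    by ring.
  by rewrite -[q *+ _]mulr_natr aux mulr_natr er -!mulrA [_ * h^`()]mulrC.
have := congr1 (horner^~ t) er; rewrite /= !hornerE subrr !(mulr0, mul0r) add0r => /eqP.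
by rewrite hornerMn mulf_eq0 (negbTE ht) mulrn_eq0 /= -/(root q t) (negbTE hq).
Qed.

(** * Quadratic forms on a plane *)

Section TangentPlane.
Variable R : realType.
Local Notation V := 'rV[R]_3.

(** The normalisation by [a] makes the distinct vectors [u1] and [u2] independent, so they span the
    plane orthogonal to [g]. *)
Lemma span_orth (a g u1 u2 w : V) : g != 0 -> u1 != u2 ->
  dot3 a u1 = 1 -> dot3 a u2 = 1 -> dot3 g u1 = 0 -> dot3 g u2 = 0 -> dot3 g w = 0 ->
  exists c d, w = c *: u1 + d *: u2.
Proof.
move=> g0 u12 a1 a2 g1 g2 gw.
have dE (x y : V) : (x *m y^T) = (dot3 y x)%:M.
  apply/matrixP => i j; rewrite !ord1 !mxE /dot3 eqxx mulr1n; apply: eq_bigr => k _.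
  by rewrite mxE mulrC.
have ker x : dot3 g x = 0 -> (x <= kermx g^T)%MS.
  by move=> h; apply/sub_kermxP; rewrite dE h; apply/matrixP => i j; rewrite !mxE mul0rn.
have u10 : u1 != 0.
  by apply: contraTneq (oner_neq0 R) => e; rewrite -a1 e -(scale0r 0) dot3Z mul0r eqxx.
have rk : (\rank (kermx g^T) = 2)%N by rewrite mxrank_ker mxrank_tr rank_rV g0.
have sub : (u1 + u2 <= kermx g^T)%MS by rewrite addsmx_sub !ker.
have rk2 : (1 < \rank (u1 + u2)%MS)%N.
  rewrite ltnNge; apply/negP => h.
  have : (u1 + u2 <= u1)%MS.
    rewrite -(mxrank_leqif_sup (addsmxSl u1 u2)) eqn_leq mxrankS ?addsmxSl //=.
    by rewrite rank_rV u10.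
  rewrite addsmx_sub => /andP[_ /sub_rVP[c e]].
  have := a2; rewrite e dot3Z a1 mulr1 => c1; move: u12; rewrite e c1 scale1r eqxx.
  by [].
have : (w <= u1 + u2)%MS.
  apply: submx_trans (ker _ gw) _; rewrite -(mxrank_leqif_sup sub) eqn_leq mxrankS //= rk.
  exact: rk2.
case/sub_addsmxP => -[c d] ->; exists (c 0 0), (d 0 0).
by rewrite [c in LHS]mx11_scalar [d in LHS]mx11_scalar !mul_scalar_mx.
Qed.

Definition bil (H : 'M[R]_3) (x y : V) : R := \sum_i \sum_j x 0 i * y 0 j * H i j.

Lemma bilDl (H : 'M[R]_3) (x x' y : V) c d : bil H (c *: x + d *: x') y = c * bil H x y + d * bil H x' y.
Proof.
rewrite /bil !mulr_sumr -big_split; apply: eq_bigr => i _ /=.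
rewrite !mulr_sumr -big_split; apply: eq_bigr => j _ /=.
by rewrite !mxE; ring.
Qed.

Lemma bilC (H : 'M[R]_3) (x y : V) : (forall i j, H i j = H j i) -> bil H x y = bil H y x.
Proof.
move=> sH; rewrite /bil exchange_big; apply: eq_bigr => i _; apply: eq_bigr => j _.
by rewrite sH [y 0 i * _]mulrC.
Qed.

(* A quadratic form on a plane with three distinct isotropic directions vanishes. *)
Lemma three_isotropic (H : 'M[R]_3) (a g u1 u2 u3 w : V) : (forall i j, H i j = H j i) -> g != 0 ->
  u1 != u2 -> u1 != u3 -> u2 != u3 ->
  dot3 a u1 = 1 -> dot3 a u2 = 1 -> dot3 a u3 = 1 ->
  dot3 g u1 = 0 -> dot3 g u2 = 0 -> dot3 g u3 = 0 -> dot3 g w = 0 ->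
  bil H u1 u1 = 0 -> bil H u2 u2 = 0 -> bil H u3 u3 = 0 -> bil H w u1 = 0.
Proof.
move=> sH g0 u12 u13 u23 a1 a2 a3 g1 g2 g3 gw b1 b2 b3.
have [c [d e]] := span_orth g0 u12 a1 a2 g1 g2 g3.
have cd : c + d = 1 by rewrite -a3 e dot3D !dot3Z a1 a2 !mulr1.
have b12 : c * d * bil H u1 u2 = 0.
  have := b3; rewrite e bilDl (bilC u1 _ sH) (bilC u2 _ sH) !bilDl b1 b2 (bilC u2 u1 sH).
  by move=> h; lra.
(* As c + d = 1, a zero coefficient would make [u3] equal to [u1] or [u2]. *)
have c0 : c != 0.
  by apply: contra u23 => /eqP c0; rewrite e c0 scale0r add0r (_ : d = 1) ?scale1r //; lra.
have d0 : d != 0.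
  by apply: contra u13 => /eqP d0; rewrite e d0 scale0r addr0 (_ : c = 1) ?scale1r //; lra.
have h12 : bil H u1 u2 = 0.
  by move/eqP: b12; rewrite !mulf_eq0 (negbTE c0) (negbTE d0) /= => /eqP.
have [c' [d' ->]] := span_orth g0 u12 a1 a2 g1 g2 gw.
by rewrite bilDl b1 (bilC u2 u1 sH) h12 !mulr0 addr0.
Qed.
End TangentPlane.

Lemma find_iotaP (A : pred nat) n : let k := find A (iota 0 n) in
  (forall j, (j < k)%N -> ~~ A j) /\ ((k < n)%N -> A k).
Proof.
move=> k; have kn : (k <= n)%N by rewrite -[n in (_ <= n)%N](size_iota 0) find_size.
split=> [j jk|kn'].
  by have := before_find 0%N jk; rewrite nth_iota ?(leq_trans jk kn) // => ->.
have : has A (iota 0 n) by rewrite has_find size_iota.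
by move/(nth_find 0%N); rewrite nth_iota.
Qed.

Lemma deriv_sum (R : nzRingType) (I : Type) (r : seq I) (f : I -> {poly R}) :
  (\sum_(i <- r) f i)^`() = \sum_(i <- r) (f i)^`().
Proof. exact: raddf_sum. Qed.

(** * Incidences on the zero set, sorted by orders of vanishing *)

Section Surface.
Variable R : realType.
Local Notation V := 'rV[R]_3.
Local Notation line := (V * V)%type.
Variables (a v : V) (F : pexp R 3) (P : seq V) (L : seq line).
Hypotheses (uP : uniq P) (uL : uniq L) (vL : forall l, l \in L -> valid_line a l).
Hypothesis F_P : forall p, p \in P -> eval F p = 0.
Hypothesis F_v : forall p, p \in P -> eval F (p + v) != 0.

Let D := deg F.
Let it k := iter k (dirder v) F.
Let res k (l : line) := restr (it k) l.1 l.2.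
(* Orders of vanishing of F in the direction v, at a point and generically along a line. *)
Definition ptord p := find (fun k => eval (it k) p != 0) (iota 0 D.+1).
Definition lnord l := find (fun k => res k l != 0) (iota 0 D.+1).

Let res_on k p l : on_line a p l -> (res k l).[dot3 a p] = eval (it k) p.
Proof. by move=> /on_lineP i; rewrite /res restrE -i. Qed.

Lemma ptord_spec p : p \in P ->
  [/\ (0 < ptord p)%N, eval (it (ptord p)) p != 0 & forall k, (k < ptord p)%N -> eval (it k) p = 0].
Proof.
move=> pP; have [h1 h2] := find_iotaP (fun k => eval (it k) p != 0) D.+1.
have lt : (ptord p < D.+1)%N.
  rewrite -[D.+1](size_iota 0) -has_find; have [k kD hk] := dirder_neq0 (F_v pP).
  by apply/hasP; exists k => //; rewrite mem_iota.
have h3 k : (k < ptord p)%N -> eval (it k) p = 0 by move=> /h1; rewrite negbK => /eqP.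
split=> //; last exact: h2.
rewrite lt0n; apply/eqP => e; have := h2 lt; rewrite -/(ptord p) e /= F_P // eqxx.
by [].
Qed.

Lemma lnord_spec l k : (k < lnord l)%N -> res k l = 0.
Proof.
have [h1 _] := find_iotaP (fun k => res k l != 0) D.+1.
by move=> /h1; rewrite negbK => /eqP.
Qed.

Lemma lnord_le p l : p \in P -> on_line a p l -> (lnord l <= ptord p)%N.
Proof.
move=> pP i; rewrite leqNgt; apply/negP => /lnord_spec r0.
by have [_ + _] := ptord_spec pP; rewrite -(res_on _ i) r0 horner0 eqxx.
Qed.

(** The search defining [lnord] could end at its default [D.+1]; a point of [P] on the line prevents
    this, since at the order of that point the restriction is nonzero. *)
Lemma lnord_res p l : p \in P -> on_line a p l -> res (lnord l) l != 0.
Proof.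
move=> pP i; have [_ h2] := find_iotaP (fun k => res k l != 0) D.+1.
have [_ hp _] := ptord_spec pP.
have := lnord_le pP i; rewrite leq_eqVlt => /orP[/eqP ->|lt].
  by apply: contraNneq hp => r0; rewrite -(res_on _ i) r0 horner0.
apply: h2; apply: leq_trans lt _.
by rewrite -ltnS -[D.+1](size_iota 0) ltnS find_size.
Qed.

Let grad l i := restr (der i (it (lnord l).-1)) l.1 l.2.
(* These Wronskians vanish when the gradient has a constant direction along l. *)
Let wr l i := res (lnord l) l * (grad l i)^`() - grad l i * (res (lnord l) l)^`().
Definition flat_line l := [forall i, wr l i == 0].
Definition flat_at p l := [forall i, root (wr l i) (dot3 a p)].
Definition regular p l := on_line a p l && (ptord p == lnord l).

Lemma roots_on_line (G : {poly R}) l : G != 0 ->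
  (count (fun p => on_line a p l && root G (dot3 a p)) P < size G)%N.
Proof.
move=> G0; rewrite -size_filter -(size_map (dot3 a)); apply: max_poly_roots => //.
  by apply/allP => x /mapP[p]; rewrite mem_filter => /andP[/andP[_ h] _] ->.
rewrite map_inj_in_uniq ?filter_uniq // => p p'.
rewrite !mem_filter => /andP[/andP[/on_lineP i _] _] /andP[/andP[/on_lineP i' _] _] e.
by rewrite i i' e.
Qed.

Lemma size_wr l i : (size (wr l i) <= (2 * D).+1)%N.
Proof.
have h1 : (size (res (lnord l) l) <= D.+1)%N.
  by apply: leq_trans (size_restr _ _ _) _; rewrite ltnS deg_iter_dirder.
have h2 : (size (grad l i) <= D.+1)%N.
  apply: leq_trans (size_restr _ _ _) _; rewrite ltnS.
  by apply: leq_trans (deg_der _ _) _; rewrite deg_iter_dirder.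
have hd (p : {poly R}) : (size p <= D.+1)%N -> (size p^`() <= D.+1)%N.
  by move=> h; apply: leq_trans (size_poly _ _) _; apply: leq_trans (leq_pred _) h.
apply: leq_trans (size_polyD _ _) _; rewrite size_polyN geq_max.
apply/andP; split; apply: leq_trans (size_polyMleq _ _) _.
  by rewrite -subn1 leq_subLR; apply: leq_trans (leq_add h1 (hd _ h2)) _; lia.
by rewrite -subn1 leq_subLR; apply: leq_trans (leq_add h2 (hd _ h1)) _; lia.
Qed.

(* g and H are the gradient and the Hessian at p of the surface it k.-1 = 0, on which p is regular. *)
Section AtPoint.
Variables (p : V) (k : nat).
Hypotheses (pP : p \in P) (kp : ptord p = k).
Let h := it k.-1.
Let g : V := \row_i eval (der i h) p.
Let H : 'M[R]_3 := \matrix_(i, j) eval (der j (der i h)) p.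

Let k0 : k = k.-1.+1.
Proof. by have [+ _ _] := ptord_spec pP; rewrite kp => /prednK. Qed.

Let itk : it k = dirder v h.
Proof. by rewrite {1}k0. Qed.

Let gv : dot3 v g != 0.
Proof.
have [_ + _] := ptord_spec pP; rewrite kp itk eval_dirder /dot3.
by congr (_ != 0); apply: eq_bigr => i _; rewrite mxE.
Qed.

Lemma sym_hess i j : H i j = H j i.
Proof. by rewrite !mxE der_comm. Qed.

Variable l : line.
Hypotheses (lk : lnord l = k) (i : on_line a p l).

Let hl : restr h l.1 l.2 = 0.
Proof. by apply: lnord_spec; rewrite lk [k in (_ < k)%N]k0. Qed.

Lemma tangent_dir : dot3 g l.2 = 0.
Proof.
have := congr1 (fun q => (q^`()).[dot3 a p]) hl; rewrite linear0 horner0 restr_der horner_sum => <-.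
by apply: eq_bigr => j _; rewrite hornerZ restrE -(on_lineP i) mxE mulrC.
Qed.

Lemma isotropic_dir : bil H l.2 l.2 = 0.
Proof.
have := congr1 (fun q => (q^`()^`()).[dot3 a p]) hl; rewrite !linear0 horner0 restr_der deriv_sum horner_sum => <-.
apply: eq_bigr => j _; rewrite derivZ restr_der hornerZ horner_sum mulr_sumr; apply: eq_bigr => j' _.
by rewrite hornerZ restrE -(on_lineP i) mxE mulrA.
Qed.

(** The first argument of [bil] is orthogonal to [g], hence tangent to the surface. So the
    Wronskians at [p] evaluate, up to scaling, the second fundamental form on tangent vectors
    against the direction of [l]. *)
Lemma wr_at j : (wr l j).[dot3 a p] = bil H (dot3 v g *: delta_mx 0 j - g 0 j *: v) l.2.
Proof.
have gE j' : (grad l j').[dot3 a p] = g 0 j' by rewrite /grad lk restrE -(on_lineP i) mxE.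
have gE' j' : ((grad l j')^`()).[dot3 a p] = \sum_i l.2 0 i * H j' i.
  rewrite /grad lk restr_der horner_sum; apply: eq_bigr => i' _.
  by rewrite hornerZ restrE -(on_lineP i) mxE.
have rE : res (lnord l) l = \sum_i v 0 i *: grad l i by rewrite /res lk itk restr_dirder /grad lk.
have r1 : (res (lnord l) l).[dot3 a p] = dot3 v g.
  by rewrite rE horner_sum; apply: eq_bigr => i' _; rewrite hornerZ gE.
have r2 : ((res (lnord l) l)^`()).[dot3 a p] = \sum_i v 0 i * \sum_i' l.2 0 i' * H i i'.
  by rewrite rE deriv_sum horner_sum; apply: eq_bigr => i' _; rewrite derivZ hornerZ gE'.
rewrite -scaleNr bilDl /wr hornerD hornerN !hornerM r1 r2 gE gE' mulNr; congr (_ * _ - _ * _).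
  rewrite /bil [RHS](bigD1 j) //= [X in _ = _ + X]big1 ?addr0 => [|j' /negbTE jj']; last first.
    by rewrite big1 // => i' _; rewrite mxE jj' andbF !mul0r.
  have d1 : (delta_mx 0 j : V) 0 j = 1 by rewrite mxE !eqxx.
  by apply: eq_bigr => i' _; rewrite d1 mul1r.
rewrite /bil; apply: eq_bigr => j' _; rewrite mulr_sumr; apply: eq_bigr => i' _.
by rewrite mulrA.
Qed.

End AtPoint.

(** Three lines of order [ptord p] through [p] give three isotropic directions in the tangent plane.
    By [three_isotropic] the form vanishes there, so by [wr_at] the first of the lines is flat at
    [p]. *)
Lemma three_lines p : p \in P ->
  (count (fun l => regular p l && ~~ flat_at p l) L <= 2)%N.
Proof.
move=> pP; rewrite -size_filter.
set s := seq.filter _ L.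
have us : uniq s by rewrite filter_uniq.
have hs l : l \in s -> [/\ l \in L, on_line a p l, lnord l = ptord p & ~~ flat_at p l].
  by rewrite mem_filter => /andP[/andP[/andP[-> /eqP ->] ->] ->].
case: s us hs => [|l1 [|l2 [|l3 s]]] //= us hs.
have [l1L i1 o1 f1] := hs l1 (mem_head _ _).
have [l2L i2 o2 _] : [/\ l2 \in L, on_line a p l2, lnord l2 = ptord p & ~~ flat_at p l2].
  by apply: hs; rewrite !inE eqxx orbT.
have [l3L i3 o3 _] : [/\ l3 \in L, on_line a p l3, lnord l3 = ptord p & ~~ flat_at p l3].
  by apply: hs; rewrite !inE eqxx !orbT.
have dist l l' : on_line a p l -> on_line a p l' -> l != l' -> l.2 != l'.2.
  move=> /on_lineP i /on_lineP i'; apply: contraNneq => e.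
  rewrite [l]surjective_pairing [l']surjective_pairing e; apply/eqP; congr pair.
  by apply: (addIr (dot3 a p *: l'.2)); rewrite -i' -e -i.
move: us; rewrite !inE !negb_or => /andP[/and3P[n12 n13 _] /andP[/andP[n23 _] _]].
have du l : l \in L -> dot3 a l.2 = 1 by move=> /vL /andP[_ /eqP].
case/negP: f1; apply/forallP => j; rewrite /root (wr_at pP erefl o1 i1); apply/eqP.
pose h := it (ptord p).-1; pose g : V := \row_i eval (der i h) p.
have gv : dot3 v g != 0.
  have [k0 + _] := ptord_spec pP; rewrite -(prednK k0) /= eval_dirder /dot3.
  by congr (_ != 0); apply: eq_bigr => i _; rewrite mxE.
apply: (@three_isotropic R _ a g l1.2 l2.2 l3.2); try by [exact: dist | exact: du].
- by move=> i' j'; apply: sym_hess.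
- by apply: contraNneq gv => ->; rewrite -(scale0r 0) dot3Z mul0r.
- exact: tangent_dir pP erefl _ o1 i1.
- exact: tangent_dir pP erefl _ o2 i2.
- exact: tangent_dir pP erefl _ o3 i3.
- rewrite dot3B !dot3Z -/g.
  have -> : dot3 g (delta_mx 0 j) = g 0 j.
    rewrite /dot3 (bigD1 j) //= big1 ?addr0 => [|i /negbTE ij]; first by rewrite !mxE !eqxx mulr1.
    by rewrite !mxE ij andbF mulr0.
  have -> : dot3 g v = dot3 v g by apply: eq_bigr => i _; rewrite mulrC.
  by rewrite mulrC subrr.
- exact: isotropic_dir pP erefl _ o1 i1.
- exact: isotropic_dir pP erefl _ o2 i2.
- exact: isotropic_dir pP erefl _ o3 i3.
Qed.

Definition flat_inc p l := regular p l && flat_line l.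

(** A point of larger order than its line is a root of the nonzero [res (lnord l) l]: at most D per
    line. A line that is not flat has a nonzero Wronskian, hence at most 2D points at which it is
    flat. By [three_lines] each point has at most two regular lines not flat at it. *)
Lemma surface_split :
  (inc_count (on_line a) P L <= 3 * D * size L + 2 * size P + inc_count flat_inc P L)%N.
Proof.
pose iA p l := on_line a p l && (eval (it (lnord l)) p == 0) && (res (lnord l) l != 0).
pose iB p l := on_line a p l && (~~ flat_line l && flat_at p l).
pose iC p l := regular p l && ~~ flat_at p l.
have bA : (inc_count iA P L <= D * size L)%N.
  apply: inc_count_lines => l _; have [r0|r0] := eqVneq (res (lnord l) l) 0.
    by rewrite (eq_count (a2 := pred0)) ?count_pred0 // => p; rewrite /iA r0 eqxx andbF.
  rewrite -ltnS; apply: (@leq_trans (size (res (lnord l) l))); last first.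
    by apply: leq_trans (size_restr _ _ _) _; rewrite ltnS deg_iter_dirder.
  apply: leq_ltn_trans (roots_on_line l r0); apply: sub_count => p /andP[/andP[i e] _].
  by rewrite i /root res_on.
have bB : (inc_count iB P L <= 2 * D * size L)%N.
  apply: inc_count_lines => l _; have [fl|/forallPn[j nz]] := boolP (flat_line l).
    by rewrite (eq_count (a2 := pred0)) ?count_pred0 // => p; rewrite /iB fl andbF.
  rewrite -ltnS; apply: leq_trans (size_wr l j); apply: leq_trans (roots_on_line l nz).
  rewrite ltnS; apply: sub_count => p /andP[i /andP[_ /forallP f]].
  by rewrite i f.
have bC : (inc_count iC P L <= 2 * size P)%N.
  by apply: inc_count_points => p pP; apply: three_lines.
apply: leq_trans (_ : inc_count iA P L + (inc_count iB P L + (inc_count iC P L + inc_count flat_inc P L)) <= _)%N; last by move: bA bB bC; lia.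
apply: leq_trans (_ : inc_count iA P L + inc_count (fun p l => iB p l || (iC p l || flat_inc p l)) P L <= _)%N.
  apply: inc_count_or => p l pP lL i; have [e|ne] := eqVneq (ptord p) (lnord l).
    rewrite /iB /iC /flat_inc /regular i e eqxx /=.
    by case: (flat_line l); case: (flat_at p l); rewrite ?orbT.
  have lt : (lnord l < ptord p)%N by rewrite ltn_neqAle eq_sym ne lnord_le.
  by have [_ _ z] := ptord_spec pP; rewrite /iA i z // eqxx (lnord_res pP i).
rewrite leq_add2l; apply: leq_trans (_ : inc_count iB P L + inc_count (fun p l => iC p l || flat_inc p l) P L <= _)%N.
  exact: inc_count_or.
by rewrite leq_add2l; apply: inc_count_or.
Qed.

(* Scaling the normal by dot3 v n = 1 makes tkey p a code of the order and tangent plane at p. *)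
Definition normal p : V :=
  \row_i (eval (der i (it (ptord p).-1)) p / eval (it (ptord p)) p).
Definition tkey p := (ptord p, normal p, dot3 (normal p) p).

Lemma normal_v p : p \in P -> dot3 v (normal p) = 1.
Proof.
move=> pP; have [k0 nz _] := ptord_spec pP.
have e : eval (it (ptord p)) p = \sum_i v 0 i * eval (der i (it (ptord p).-1)) p.
  by rewrite -[in LHS](prednK k0) /= eval_dirder.
rewrite /dot3 (eq_bigr (fun i => v 0 i * eval (der i (it (ptord p).-1)) p / eval (it (ptord p)) p)).
  by rewrite -mulr_suml -e divff.
by move=> i _; rewrite mxE mulrA.
Qed.

Lemma normal_tangent p l : p \in P -> regular p l -> dot3 (normal p) l.2 = 0.
Proof.
move=> pP /andP[i /eqP o]; have := tangent_dir pP erefl (esym o) i.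
have -> : dot3 (normal p) l.2 = (eval (it (ptord p)) p)^-1 *
    dot3 (\row_i eval (der i (it (ptord p).-1)) p) l.2.
  rewrite /dot3 mulr_sumr; apply: eq_bigr => j _; rewrite !mxE; ring.
by move=> ->; rewrite mulr0.
Qed.

(** Along a flat line [wronskian_const] makes the scaled normal constant, and the line is orthogonal
    to it, so the offset agrees too. A line therefore enters at most one class. *)
Lemma flat_normal p p' l : p \in P -> p' \in P -> flat_inc p l -> flat_inc p' l -> tkey p = tkey p'.
Proof.
move=> pP p'P /andP[r fl] /andP[r' _].
have [/andP[i /eqP o] /andP[i' /eqP o']] := (r, r').
have nE q : q \in P -> on_line a q l -> ptord q = lnord l ->
    forall j, normal q 0 j = (grad l j).[dot3 a q] / (res (lnord l) l).[dot3 a q].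
  by move=> qP /[dup] iq /on_lineP eq_ oq j; rewrite mxE (res_on _ iq) oq /grad restrE -eq_.
have nn : normal p = normal p'.
  apply/rowP => j; rewrite !nE //; apply: wronskian_const.
  - by apply/eqP; rewrite -subr_eq0; exact: (forallP fl j).
  - by rewrite (res_on _ i) -o; have [] := ptord_spec pP.
  - by rewrite (res_on _ i') -o'; have [] := ptord_spec p'P.
have e : dot3 (normal p) p = dot3 (normal p) p'.
  rewrite [X in dot3 _ X = _](on_lineP i) [X in _ = dot3 _ X](on_lineP i') !dot3D !dot3Z.
  by rewrite (normal_tangent pP r) !mulr0.
by rewrite /tkey o o' -nn e.
Qed.

Variable s : nat.
Hypothesis hs : forall (w : V) (c : R), w != 0 ->
  (count (fun l => (dot3 w l.1 == c) && (dot3 w l.2 == 0)%R) L <= s)%N.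

Lemma flat_class_lines c : (size (class_lines tkey flat_inc P L c) <= s)%N.
Proof.
rewrite /class_lines size_filter.
have [/hasP[p0 p0P /eqP k0]|nh] := boolP (has (fun p => tkey p == c) P); last first.
  rewrite (eq_count (a2 := pred0)) ?count_pred0 // => l; apply/negbTE/hasPn => p.
  rewrite mem_filter => /andP[e pP]; case/hasP: nh; by exists p.
have w0 : normal p0 != 0.
  have := normal_v p0P; apply: contra_eqN => /eqP ->.
  by rewrite -(scale0r 0) dot3Z mul0r eq_sym oner_eq0.
apply: leq_trans (hs (dot3 (normal p0) p0) w0); apply: sub_count => l /hasP[p].
rewrite mem_filter => /andP[/eqP e pP] /andP[r _].
move: e; rewrite -k0 => -[_ <- <-].
have t := normal_tangent pP r; rewrite t eqxx andbT.
case/andP: r => /on_lineP i _.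
by rewrite [X in _ == dot3 _ X]i dot3D dot3Z t mulr0 addr0.
Qed.

(** Flat incidences are summed over the tangent planes. A plane has at most [s] lines, so one factor
    n^(1/3) of its Szemeredi-Trotter bound is replaced by s^(1/3); Hoelder's inequality adds up the
    rest, since points and lines are not shared between classes. *)
Lemma surface_bound : (0 < size P)%N -> (0 < size L)%N ->
  (inc_count (on_line a) P L)%:R <= 3 * D%:R * (size L)%:R + 2 * (size P)%:R +
   85 * (cbrt (size P)%:R ^+ 2 * cbrt (size L)%:R * cbrt s%:R + (size P)%:R + (size L)%:R) :> R.
Proof.
move=> P0 L0.
have h1 : (inc_count (on_line a) P L)%:R <= 3 * D%:R * (size L)%:R + 2 * (size P)%:R
   + (inc_count flat_inc P L)%:R :> R.
  by rewrite -!natrM -!natrD ler_nat; exact: surface_split.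
apply: le_trans h1 _; rewrite lerD2l.
rewrite (inc_count_classes tkey) natr_sum.
set C := keys tkey P; pose m c := size (class_pts tkey P c); pose n c := size (class_lines tkey flat_inc P L c).
have sm : (\sum_(c <- C) m c = size P)%N by apply: sum_class_pts.
have sn : (\sum_(c <- C) n c <= size L)%N.
  rewrite -[leqRHS]mul1n; apply: sum_class_lines => l lL.
  set t := undup _; case et : t => [|x [|y t']] //.
  have ut : uniq t := undup_uniq _.
  have ht z : z \in t -> exists2 p, p \in P /\ flat_inc p l & z = tkey p.
    by rewrite mem_undup => /mapP[p]; rewrite mem_filter => /andP[i pP] ->; exists p.
  have [p [pP i] ex] : exists2 p, p \in P /\ flat_inc p l & x = tkey p by apply: ht; rewrite et mem_head.
  have [p' [p'P i'] ey] : exists2 p, p \in P /\ flat_inc p l & y = tkey p by apply: ht; rewrite et !inE eqxx orbT.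
  by move: ut; rewrite et /= ex ey (flat_normal pP p'P i i') mem_head.
have step c : (inc_count flat_inc (class_pts tkey P c) (class_lines tkey flat_inc P L c))%:R
    <= 85 * (cbrt s%:R * (cbrt (n c)%:R * cbrt (m c)%:R ^+ 2) + (m c)%:R + (n c)%:R) :> R.
  apply: (@le_trans _ _ (stbound R (m c) (n c))).
    apply: le_trans (space_st (a := a) _ _ _); last 3 first.
    - exact: filter_uniq.
    - exact: filter_uniq.
    - by apply/allP => l; rewrite mem_filter => /andP[_ /vL].
    by rewrite ler_nat; apply: inc_count_sub => p l _ _ /andP[/andP[]].
  rewrite /stbound ler_pM2l // !lerD2r mulrC expr2 -mulrA mulrA.
  rewrite mulrA ler_wpM2r ?sqr_ge0 // ler_wpM2r ?cbrt_ge0 //.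
  by apply: cbrt_le; rewrite ?cbrt_ge0 // cbrtK // ler_nat; apply: flat_class_lines.
apply: le_trans (ler_sum _ (fun c _ => step c)) _.
rewrite -mulr_sumr !big_split /= -mulr_sumr ler_pM2l // -!natr_sum sm.
have pos k : (0 < k)%N -> 0 < cbrt k%:R :> R.
  by move=> k0; rewrite powR_gt0 // ltr0n.
have hold : \sum_(c <- C) cbrt (n c)%:R * cbrt (m c)%:R ^+ 2 <= cbrt (size L)%:R * cbrt (size P)%:R ^+ 2 :> R.
  apply: hoelder21; try by [move=> *; apply: cbrt_ge0 | apply: pos].
    by rewrite cbrtK // (eq_bigr (fun c => (n c)%:R)) -?natr_sum ?ler_nat // => c _; rewrite cbrtK.
  by rewrite cbrtK // (eq_bigr (fun c => (m c)%:R)) -?natr_sum ?ler_nat ?sm // => c _; rewrite cbrtK.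
have := ler_wpM2l (cbrt_ge0 s%:R) hold; rewrite mulrA => hold'.
have sn' : (\sum_(c <- C) n c)%:R <= (size L)%:R :> R by rewrite ler_nat.
have -> : cbrt (size P)%:R ^+ 2 * cbrt (size L)%:R * cbrt s%:R =
  cbrt s%:R * cbrt (size L)%:R * cbrt (size P)%:R ^+ 2 :> R by ring.
lra.
Qed.

End Surface.

(** * The incidence bound in space *)

Section SpaceBound.
Variable R : realType.
Local Notation V := 'rV[R]_3.
Local Notation line := (V * V)%type.
Variables (a : V) (P : seq V) (L : seq line) (s : nat).
Hypotheses (uP : uniq P) (uL : uniq L) (vL : forall l, l \in L -> valid_line a l).
Hypothesis hs : forall (w : V) (c : R), w != 0 ->
  (count (fun l => (dot3 w l.1 == c) && (dot3 w l.2 == 0)%R) L <= s)%N.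
Hypotheses (P0 : (0 < size P)%N) (L0 : (0 < size L)%N).
Local Notation m := ((size P)%:R : R).
Local Notation n := ((size L)%:R : R).

Lemma cbrt_nat_gt0 k : (0 < k)%N -> 0 < cbrt k%:R :> R.
Proof. by move=> k0; rewrite powR_gt0 // ltr0n. Qed.

Lemma le_cbrt_nat j k : (j <= k)%N -> cbrt j%:R <= cbrt k%:R :> R.
Proof. by move=> jk; apply: cbrt_le; rewrite ?cbrt_ge0 // cbrtK // ler_nat. Qed.

(** A cell has at most m / E^3 points, so one factor m^(1/3) of its Szemeredi-Trotter bound becomes
    m^(1/3) / E. The lines meet at most 19 E n cells in total, and Hoelder's inequality sums over
    the cells. *)
Lemma cells_bound fs K : (deg (prodexp fs) <= 18 * 2 ^ K)%N ->
  (forall c, 2 ^ (3 * K) * count (in_cell fs c) P <= size P)%N ->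
  (inc_count (on_line a) [seq p <- P | eval (prodexp fs) p != 0] L)%:R <=
  85 * (9 * (cbrt m ^+ 2 * cbrt n ^+ 2 / cbrt (2 ^ K)%:R) + m + 19 * (2 ^ K)%:R * n) :> R.
Proof.
move=> hD hcell; set P1 := [seq p <- P | _]; set F := prodexp fs in hD P1 *.
set E : R := (2 ^ K)%:R; set e := cbrt E.
have E0 : 0 < E by rewrite ltr0n expn_gt0.
have e0 : 0 < e by rewrite powR_gt0.
have e3 : e ^+ 3 = E by apply: cbrtK; apply: ltW.
have uP1 : uniq P1 by apply: filter_uniq.
rewrite (inc_count_classes (sign_vector fs)) natr_sum.
set C := keys _ _; pose mc c := size (class_pts (sign_vector fs) P1 c).
pose nc c := size (class_lines (sign_vector fs) (on_line a) P1 L c).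
have sm : (\sum_(c <- C) mc c <= size P)%N by rewrite sum_class_pts size_filter count_size.
have sn : (\sum_(c <- C) nc c <= 19 * 2 ^ K * size L)%N.
  apply: (@leq_trans ((deg F).+1 * size L)).
    by apply: sum_class_lines => l lL; exact: (cells_on_line (@on_lineP R a) fs P l).
  by rewrite leq_mul2r; apply/orP; right; have : (0 < 2 ^ K)%N by [rewrite expn_gt0]; lia.
have mce c : cbrt (mc c)%:R <= cbrt m / E.
  apply: cbrt_le => //; first by rewrite divr_ge0 ?cbrt_ge0 // ltW.
  rewrite expr_div_n cbrtK // ler_pdivlMr ?exprn_gt0 // mulrC /E -natrX -natrM ler_nat.
  apply: leq_trans (hcell c); rewrite -expnM [(K * 3)%N]mulnC leq_mul2l; apply/orP; right.
  rewrite /mc /class_pts /P1 -filter_predI size_filter; apply: sub_count => p /=.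
  by rewrite /in_cell andbC.
have step c : (inc_count (on_line a) (class_pts (sign_vector fs) P1 c)
     (class_lines (sign_vector fs) (on_line a) P1 L c))%:R
   <= 85 * (cbrt m / E * (cbrt (mc c)%:R * cbrt (nc c)%:R ^+ 2) + (mc c)%:R + (nc c)%:R) :> R.
  apply: (@le_trans _ _ (stbound R (mc c) (nc c))).
    by apply: space_st; rewrite ?filter_uniq //; apply/allP => l; rewrite mem_filter => /andP[_ /vL].
  rewrite /stbound ler_pM2l // !lerD2r [cbrt (mc c)%:R ^+ 2]expr2 -mulrA.
  by rewrite ler_wpM2r ?mce // mulr_ge0 ?sqr_ge0 ?cbrt_ge0.
apply: le_trans (ler_sum _ (fun c _ => step c)) _.
rewrite -mulr_sumr !big_split /= -mulr_sumr ler_pM2l // -!natr_sum.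
have m0 := cbrt_nat_gt0 P0; have n0 := cbrt_nat_gt0 L0.
(* The factor 3 absorbs the 19, as 3^3 = 27. *)
have hold : \sum_(c <- C) cbrt (mc c)%:R * cbrt (nc c)%:R ^+ 2 <= cbrt m * (3 * (e * cbrt n)) ^+ 2.
  apply: hoelder21 => //; try by move=> *; apply: cbrt_ge0.
  - by rewrite mulr_gt0 // mulr_gt0.
  - by rewrite cbrtK // (eq_bigr (fun c => (mc c)%:R)) -?natr_sum ?ler_nat // => c _; rewrite cbrtK.
  - rewrite (eq_bigr (fun c => (nc c)%:R)) => [|c _]; last by rewrite cbrtK.
    rewrite -natr_sum !exprMn e3 cbrtK //.
    apply: (@le_trans _ _ (19 * E * n)); first by rewrite -!natrM ler_nat.
    have : 0 <= E * n by rewrite mulr_ge0 // ltW.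
    lra.
have := ler_wpM2l (divr_ge0 (cbrt_ge0 m) (ltW E0)) hold.
have -> : cbrt m / E * (cbrt m * (3 * (e * cbrt n)) ^+ 2) = 9 * (cbrt m ^+ 2 * cbrt n ^+ 2 / e).
  by rewrite -e3; field; rewrite gt_eqF.
have sm' : (\sum_(c <- C) mc c)%:R <= m by rewrite ler_nat.
have sn' : (\sum_(c <- C) nc c)%:R <= 19 * E * n by rewrite -!natrM ler_nat.
lra.
Qed.

(** Off the zero set [cells_bound] applies, on it [surface_bound] with one direction [v] good for
    all its points. The constants are 765 = 85 * 9, 1669 = 85 * 19 + 3 * 18 and 172 = 85 + 85 +
    2. *)
Lemma space_bound K : (inc_count (on_line a) P L)%:R <=
  765 * (cbrt m ^+ 2 * cbrt n ^+ 2 / cbrt (2 ^ K)%:R) + 1669 * (2 ^ K)%:R * n + 172 * m + 85 * n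
  + 85 * (cbrt m ^+ 2 * cbrt n * cbrt s%:R) :> R.
Proof.
have [fs [[q hq] hD hcell]] := polynomial_partition K P.
have {}hD : (deg (prodexp fs) <= 18 * 2 ^ K)%N by [].
have h1 := cells_bound hD hcell.
set F := prodexp fs in hq hD h1.
set P1 := [seq p <- P | _] in h1.
pose Pz := [seq p <- P | eval F p == 0].
have hsplit : inc_count (on_line a) P L = (inc_count (on_line a) P1 L + inc_count (on_line a) Pz L)%N.
  rewrite /inc_count !big_filter (bigID (fun p => eval F p != 0)) /=; congr addn.
  by apply: eq_bigl => p; rewrite negbK.
have h2 : (inc_count (on_line a) Pz L)%:R <= 54 * (2 ^ K)%:R * n + 87 * m + 85 * n
    + 85 * (cbrt m ^+ 2 * cbrt n * cbrt s%:R).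
  have sP : (size Pz <= size P)%N by rewrite size_filter count_size.
  have c0 k := cbrt_ge0 (k%:R : R).
  have E0 : 0 <= (2 ^ K)%:R :> R by [].
  have rhs0 : 0 <= 54 * (2 ^ K)%:R * n + 87 * m + 85 * n + 85 * (cbrt m ^+ 2 * cbrt n * cbrt s%:R).
    by rewrite !addr_ge0 // !mulr_ge0 // ?c0 // exprn_ge0 ?c0.
  case: (posnP (size Pz)) => [/size0nil ->|Pz0]; first by rewrite /inc_count big_nil.
  have [v hv] := ex_direction Pz hq.
  have sb : (inc_count (on_line a) Pz L)%:R <= 3 * (deg F)%:R * n + 2 * (size Pz)%:R +
     85 * (cbrt (size Pz)%:R ^+ 2 * cbrt n * cbrt s%:R + (size Pz)%:R + n) :> R.
    apply: (surface_bound _ uL vL _ hv hs) => //; first exact: filter_uniq.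
    by move=> p; rewrite mem_filter => /andP[/eqP].
  apply: le_trans sb _.
  have t1 : 3 * (deg F)%:R * n <= 54 * (2 ^ K)%:R * n.
    by rewrite -!natrM ler_nat leq_mul //; move: hD; lia.
  have t2 : (size Pz)%:R <= m by rewrite ler_nat.
  have t4 : cbrt (size Pz)%:R ^+ 2 * cbrt n * cbrt s%:R <= cbrt m ^+ 2 * cbrt n * cbrt s%:R.
    by do 2!apply: ler_wpM2r => //; rewrite ler_pXn2r ?nnegrE ?le_cbrt_nat.
  lra.
have : (inc_count (on_line a) P L)%:R = (inc_count (on_line a) P1 L)%:R + (inc_count (on_line a) Pz L)%:R :> R.
  by rewrite hsplit natrD.
lra.
Qed.

(* With z = m^(1/2) and y = n^(1/4), the degree 2^K is chosen of order z / y. *)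
Lemma incidence_bound :
  (inc_count (on_line a) P L)%:R <= 4000 * (m `^ 2^-1 * n `^ (3 / 4) + m)
    + 4000 * (m `^ (2 / 3) * n `^ 3^-1 * s%:R `^ 3^-1 + n) :> R.
Proof.
have m0 : 0 < m by rewrite ltr0n. have n0 : 0 < n by rewrite ltr0n.
set z := m `^ 2^-1; set y := n `^ 4^-1.
have z0 : 0 < z by rewrite powR_gt0.
have y0 : 0 < y by rewrite powR_gt0.
have z2 : z ^+ 2 = m by rewrite /z -powR_mulrn ?powR_ge0 // -powRrM mulVf // powRr1 // ltW.
have y4 : y ^+ 4 = n by rewrite /y -powR_mulrn ?powR_ge0 // -powRrM mulVf // powRr1 // ltW.
have y3 : n `^ (3 / 4) = y ^+ 3 by rewrite /y -powR_mulrn ?powR_ge0 // -powRrM mulrC.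
have m23 : m `^ (2 / 3) = cbrt m ^+ 2 by rewrite /cbrt -powR_mulrn ?powR_ge0 // -powRrM mulrC.
rewrite y3 m23 -/(cbrt n) -/(cbrt s%:R).
have T0 : 0 <= z * y ^+ 3 by rewrite mulr_ge0 ?exprn_ge0 // ltW.
have S0 : 0 <= cbrt m ^+ 2 * cbrt n * cbrt s%:R.
  by rewrite !mulr_ge0 ?cbrt_ge0 // exprn_ge0 ?cbrt_ge0.
(* For m^2 <= n the trivial bound suffices; otherwise z / y >= 1, so a power of two of that order
   exists. *)
have [mn|mn] := leP (m ^+ 2) n.
  have : (inc_count (on_line a) P L)%:R <= n + m ^+ 2.
    rewrite -natrX -natrD ler_nat; apply: inc_count_trivial => //; exact: on_line_linear.
  lra.
have x1 : 1 <= z / y.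
  rewrite ler_pdivlMr // mul1r -(ler_pXn2r (n := 4)) ?nnegrE ?(ltW z0) ?(ltW y0) // y4.
  by rewrite (exprM z 2 2) z2 ltW.
have [K /andP[k1 k2]] := dyadic x1.
apply: le_trans (space_bound K) _; set E : R := (2 ^ K)%:R in k1 k2 *.
have E0 : 0 < E by rewrite ltr0n expn_gt0.
have k3 : E * y <= z by rewrite -ler_pdivlMr.
have k4 : z < 2 * (E * y) by rewrite mulrA -ltr_pdivrMr.
have t1 : E * n <= z * y ^+ 3.
  by rewrite -y4 (exprS y 3) mulrA ler_wpM2r // exprn_ge0 // ltW.
have t2 : cbrt m ^+ 2 * cbrt n ^+ 2 / cbrt E <= 2 * (z * y ^+ 3).
  have s1 : 0 <= cbrt m ^+ 2 * cbrt n ^+ 2 / cbrt E.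
    by rewrite divr_ge0 ?cbrt_ge0 // mulr_ge0 // exprn_ge0 ?cbrt_ge0.
  have s2 : 0 <= 2 * (z * y ^+ 3) by rewrite mulr_ge0.
  rewrite -(ler_pXn2r (n := 3)) ?nnegrE //.
  rewrite expr_div_n exprMn -!exprM !(mulnC 2 3) !exprM !cbrtK ?(ltW m0) ?(ltW n0) ?(ltW E0) //.
  rewrite ler_pdivrMr // -z2 -y4.
  have -> : (2 * (z * y ^+ 3)) ^+ 3 * E = z ^+ 3 * y ^+ 8 * (8 * (E * y)) by ring.
  have -> : z ^+ 2 ^+ 2 * y ^+ 4 ^+ 2 = z ^+ 3 * y ^+ 8 * z by ring.
  apply: ler_wpM2l; first by rewrite mulr_ge0 // exprn_ge0 // ltW.
  have := mulr_gt0 E0 y0; lra.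
move: t1 t2; set u := _ / cbrt E; lra.
Qed.

End SpaceBound.

(** * From sets of points and lines to codes *)

Section LineCodes.
Variable R : realType.
Local Notation V := 'rV[R]_3.
Local Notation line := (V * V)%type.

Lemma card_fset_sep (K : choiceType) (A : {fset K}) (B : pred K) :
  #|` [fset x in A | B x]%fset| = count B A.
Proof.
rewrite -size_filter; apply: perm_size; apply: uniq_perm.
- exact: fset_uniq.
- by rewrite filter_uniq // fset_uniq.
by move=> x; rewrite mem_filter !inE /= andbC.
Qed.

(** A functional [a] that is nonzero on all directions allows each line to be normalised by shifting
    its base point and scaling its direction. *)
Lemma line_codes (L : {fset set V}) : (forall l, l \in L -> is_line l) ->
  exists (a : V) (code : set V -> line), forall l, l \in L ->
    valid_line a (code l) /\ forall x, (x \in l) = on_line a x (code l).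
Proof.
move=> hL.
have /choice[f hf] : forall l : set V, exists pd : V * V, l \in L ->
    pd.2 != 0 /\ l = [set pd.1 + t *: pd.2 | t in [set: R]]%classic.
  move=> l; have [/hL[p [d h]]|nl] := boolP (l \in L); last by exists (0, 0).
  by exists (p, d).
have [a ha] := generic_vector [seq (f l).2 | l <- L].
exists a, (fun l => ((f l).1 - (dot3 a (f l).1 / dot3 a (f l).2) *: (f l).2, (dot3 a (f l).2)^-1 *: (f l).2)).
move=> l lL; have [d0 lE] := hf l lL.
have ad : dot3 a (f l).2 != 0 by apply: ha => //; apply: map_f.
split.
  by rewrite /valid_line /= dot3B !dot3Z divfK // subrr eqxx mulVf ?eqxx.
move=> x; apply/idP/idP.
  rewrite inE [X in X x]lE => -[t _ <-]; rewrite /on_line /= dot3D !dot3Z.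
  apply/eqP; rewrite scalerA -addrA -scaleNr -scalerDl; congr (_ + _ *: _).
  by field.
move=> /eqP e; rewrite inE [X in X x]lE; exists ((dot3 a x - dot3 a (f l).1) / dot3 a (f l).2) => //.
rewrite [in RHS]e /= scalerA -addrA -scaleNr -scalerDl; congr (_ + _ *: _).
by field.
Qed.

Lemma incidences_bound : exists2 K : R, 0 < K &
  forall (P : {fset V}) (L : {fset set V}) (s : nat),
  (forall l, l \in L -> is_line l) ->
  (forall H, is_plane H -> (lines_in L H <= s)%N) ->
  (0 < #|` P|)%N -> (0 < #|` L|)%N ->
  forall m n : R, m = (#|` P|)%:R -> n = (#|` L|)%:R ->
  (incidences P L)%:R <= K * (m `^ 2^-1 * n `^ (3 / 4) + m)
    + K * (m `^ (2 / 3) * n `^ 3^-1 * s%:R `^ 3^-1 + n).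
Proof.
exists 4000; first by rewrite ltr0n.
move=> P L s hL hH P0 L0 m n -> ->; have [a [code hc]] := line_codes hL.
have -> : incidences P L = inc_count (on_line a) P (map code L).
  rewrite /incidences /inc_count; apply: eq_bigr => p _.
  rewrite card_fset_sep big_map -sum1_count [LHS]big_mkcond big_seq [RHS]big_seq.
  apply: eq_bigr => l /hc[_ h].
  by rewrite h; case: (on_line _ _ _).
have ic : {in L &, injective code}.
  move=> l l' /hc[_ h] /hc[_ h'] e; apply/seteqP; split => x hx.
    by apply/set_mem; rewrite h' -e -h; apply/mem_set.
  by apply/set_mem; rewrite h e -h'; apply/mem_set.
have <- : size (map code L) = #|` L| by rewrite size_map.
 apply: incidence_bound.
- exact: fset_uniq.
- by rewrite map_inj_in_uniq // fset_uniq.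
- by move=> _ /mapP[l lL ->]; have [] := hc l lL.
- move=> w c w0; have pl : is_plane [set x | dot3 w x = c]%classic by exists w, c.
  apply: leq_trans (hH _ pl); rewrite /lines_in card_fset_sep count_map.
  rewrite -!size_filter; apply: uniq_leq_size; first by rewrite filter_uniq // fset_uniq.
  move=> l; rewrite !mem_filter /= => /andP[/andP[/eqP h1 /eqP h2] lL].
  rewrite lL andbT; apply/asboolP => x hx /=.
  have [_ h] := hc l lL; have := mem_set hx; rewrite h => /eqP ->.
  by rewrite dot3D dot3Z h1 h2 mulr0 addr0.
- exact: P0.
- by rewrite size_map.
Qed.

Lemma powR2_ge1 (x : R) : 0 <= x -> 1 <= 2 `^ x.
Proof. by move=> x0; rewrite -[leLHS](powRr0 2) ler_powR // ler1n. Qed.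

End LineCodes.

Unset Implicit Arguments.
Local Open Scope classical_set_scope.
Local Open Scope ring_scope.

Theorem theorem2 (R : realType) :
  exists B C b : R, 0 < B /\ 0 < C /\ 1 < b /\
  forall (P : {fset 'rV[R]_3}) (L : {fset set 'rV[R]_3}) (s : nat),
    (forall l, l \in L -> is_line l) ->
    (s <= #|` L |)%N ->
    (forall H : set 'rV[R]_3, is_plane H -> (lines_in L H <= s)%N) ->
    let m : R := (#|` P |)%:R in
    let n : R := (#|` L |)%:R in
    m ^+ 2 != n ^+ 3 ->
    let A : R :=
      if m ^+ 2 < n ^+ 3
      then C * b `^ (ln (m ^+ 2 * n) / ln (n ^+ 3 / m ^+ 2))
      else C * b `^ (ln (m ^+ 3 / n ^+ 4) / ln (m ^+ 2 / n ^+ 3)) in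
    (incidences P L)%:R
      <= A * (m `^ (2^-1) * n `^ (3 / 4) + m)
         + B * (m `^ (2 / 3) * n `^ (3^-1) * (s%:R) `^ (3^-1) + n).
Proof.
have [K K0 hK] := incidences_bound R.
(* Any base above 1 serves: both exponents turn out nonnegative, so [A] is at least [K]. *)
exists K, K, 2; do 3![split => //]; first by rewrite ltr1n.
move=> P L s hL _ hH m n mn; cbv zeta; set A := (if _ then _ else _).
have A0 : 0 <= A by rewrite /A; case: ifP => _; rewrite mulr_ge0 ?powR_ge0 // ltW.
have rhs1 : 0 <= m `^ (2^-1) * n `^ (3 / 4) + m by rewrite addr_ge0 ?mulr_ge0 ?powR_ge0.
have rhs2 : 0 <= m `^ (2 / 3) * n `^ (3^-1) * (s%:R) `^ (3^-1) + n.
  by rewrite addr_ge0 ?mulr_ge0 ?powR_ge0.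
have triv : incidences P L = 0%N ->
    (incidences P L)%:R <= A * (m `^ (2^-1) * n `^ (3 / 4) + m)
    + K * (m `^ (2 / 3) * n `^ (3^-1) * (s%:R) `^ (3^-1) + n).
  by move=> ->; rewrite addr_ge0 ?mulr_ge0 // ltW.
have [p0|P0] := posnP #|` P|.
  by apply: triv; rewrite /incidences (size0nil p0) big_nil.
have [l0|L0] := posnP #|` L|.
  apply: triv; rewrite /incidences big1 // => p _.
  by rewrite card_fset_sep (size0nil l0).
apply: le_trans (hK P L s hL hH P0 L0 m n erefl erefl) _; rewrite lerD2r ler_wpM2r //.
have m1 : 1 <= m by rewrite ler1n. have n1 : 1 <= n by rewrite ler1n.
have m0 : 0 < m by lra. have n0 : 0 < n by lra.
have mk k : 0 < m ^+ k by rewrite exprn_gt0.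
have nk k : 0 < n ^+ k by rewrite exprn_gt0.
rewrite /A; case: ltP => h; (apply: ler_peMr; [exact: ltW | apply: powR2_ge1; apply: divr_ge0; apply: ln_ge0]).
- by rewrite -[1]mulr1 ler_pM // expr_ge1 // ltW.
- by rewrite ler_pdivlMr // mul1r ltW.
(* Squared, the claim n^4 <= m^3 reads n^8 <= m^6; it follows from n^8 <= n^9 <= m^6, by n >= 1 and
   n^3 <= m^2. *)
- rewrite ler_pdivlMr // mul1r -(ler_pXn2r (n := 2)) ?nnegrE ?(ltW (mk _)) ?(ltW (nk _)) //.
  apply: (@le_trans _ _ (n ^+ 3 ^+ 3)); first by rewrite -!exprM ler_weXn2l.
  by rewrite -(exprM m 3 2) (exprM m 2 3) ler_pXn2r ?nnegrE ?(ltW (mk _)) ?(ltW (nk _)).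
- by rewrite ler_pdivlMr // mul1r.
Qed.
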